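(* Fix integers $d\ge n\ge 3$ and let $W\subset\mathbb{P}^n$ be a quadric hypersurface of rank $\rho\ge 4$. Then there is a degree $d$ bamboo $T\subset\mathbb{P}^n$ intersecting $W$ transversally such that the finite set $T\cap W$ has maximal rank in $W$, i.e. for every integer $t$ the restriction map $H^0(\mathcal{O}_W(t))\to H^0(\mathcal{O}_{T\cap W}(t))$ is injective or surjective.
   Context: A degree $d$ tree $T\subset\mathbb{P}^n$ is a connected nodal curve of degree $d$ and arithmetic genus $0$ all of whose irreducible components are lines. A degree $d$ bamboo is a degree $d$ tree which is either a line ($d=1$) or, for $d\ge2$, admits an ordering $L_1,\dots,L_d$ of its components with $L_i\cap L_j\neq\emptyset$ if and only if $|i-j|\le 1$ (a chain of lines). *)

(* Defs.v *)
From HB Require Import structures.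
From mathcomp Require Import all_boot all_order all_algebra.
From mathcomp Require Import mpoly.

Set Implicit Arguments.
Unset Strict Implicit.
Unset Printing Implicit Defensive.

Import Order.TTheory GRing.Theory Num.Theory.
Local Open Scope ring_scope.

(* Projective space P^n over F: nonzero row vectors of length n+1 up to
   scalars.  A point of P^n is represented by a nonzero p : 'rV[F]_(n.+1). *)

Section Geometry.
Variables (F : fieldType) (n : nat).
Local Notation vec := 'rV[F]_(n.+1).

(* Quadric given by a symmetric matrix A: W = { [p] | p A p^T = 0 }. *)
Definition qform (A : 'M[F]_(n.+1)) (p : vec) : F := (p *m A *m p^T) 0 0.

Definition qpolar (A : 'M[F]_(n.+1)) (p v : vec) : F := (p *m A *m v^T) 0 0.

Definition quadric_poly (A : 'M[F]_(n.+1)) : {mpoly F[n.+1]} :=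
  \sum_(i < n.+1) \sum_(j < n.+1) A i j *: ('X_i * 'X_j).

Definition evalp (f : {mpoly F[n.+1]}) (p : vec) : F := f.@[fun i => p 0 i].

(* A line of P^n is the projectivization of a 2-dim subspace, given as the
   row space of a rank 2 matrix B; the point [p] lies on it iff p is in the
   row space of B. *)
Definition on_line (p : vec) (B : 'M[F]_(2, n.+1)) : bool := (p <= B)%MS.

Definition lines_meet (B C : 'M[F]_(2, n.+1)) : Prop :=
  exists p : vec, p != 0 /\ on_line p B /\ on_line p C.

(* Degree d bamboo: d distinct lines L_0..L_{d-1}, with L_i meeting L_j
   iff |i - j| <= 1.  (Such a chain is automatically a connected nodal curve
   of arithmetic genus 0 all of whose components are lines, i.e. a tree.) *)
Definition is_bamboo (d : nat) (L : 'I_d -> 'M[F]_(2, n.+1)) : Prop :=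
  [/\ forall i, \rank (L i) = 2%N,
      forall i j, (L i == L j)%MS -> i = j &
      forall i j : 'I_d, lines_meet (L i) (L j) <-> (i <= j.+1 /\ j <= i.+1)%N].

Definition on_bamboo (d : nat) (L : 'I_d -> 'M[F]_(2, n.+1)) (p : vec) : Prop :=
  exists i, on_line p (L i).

Definition in_TW (A : 'M[F]_(n.+1)) (d : nat) (L : 'I_d -> 'M[F]_(2, n.+1))
  (p : vec) : Prop :=
  [/\ p != 0, on_bamboo L p & qform A p = 0].

(* T meets W transversally: at every point p of T \cap W, T is smooth at p
   (p lies on exactly one component), W is smooth at p (p A <> 0, i.e. the
   gradient 2 p A of the equation does not vanish), and the tangent line
   of T at p (the component L_i through p) is not contained in the tangent
   hyperplane T_pW = { v | p A v^T = 0 }. *)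
Definition meets_transversally (A : 'M[F]_(n.+1)) (d : nat)
  (L : 'I_d -> 'M[F]_(2, n.+1)) : Prop :=
  forall p, in_TW A L p ->
    [/\ forall i j, on_line p (L i) -> on_line p (L j) -> i = j,
        p *m A != 0 &
        forall i, on_line p (L i) ->
          exists v : vec, on_line v (L i) /\ qpolar A p v != 0].

Definition repr_TW (A : 'M[F]_(n.+1)) (d : nat) (L : 'I_d -> 'M[F]_(2, n.+1))
  (zs : seq vec) : Prop :=
  [/\ forall z, z \in zs -> in_TW A L z,
      forall p, in_TW A L p -> exists2 z, z \in zs & (p <= z)%MS &
      pairwise (fun z w : vec => ~~ (z <= w)%MS) zs].

(* Maximal rank of the finite set Z = T \cap W (with representatives zs) in
   the quadric W in degree t, using H^0(O_W(t)) = S_t / Q S_{t-2}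
   (S = F[X_0..X_n], Q = equation of W; valid for t >= 0 since W is a
   hypersurface) and H^0(O_Z(t)) = F^Z (via the representatives zs).
   - injectivity of the restriction: every degree t form vanishing on Z
     is a multiple of Q;
   - surjectivity: every vector of values on Z is attained by a degree t
     form. *)
Definition restr_injective (A : 'M[F]_(n.+1)) (d : nat)
  (L : 'I_d -> 'M[F]_(2, n.+1)) (t : nat) : Prop :=
  forall f : {mpoly F[n.+1]}, f \is t.-homog ->
    (forall p, in_TW A L p -> evalp f p = 0) ->
    exists g : {mpoly F[n.+1]}, f = quadric_poly A * g.

Definition restr_surjective (zs : seq vec) (t : nat) : Prop :=
  forall vs : seq F, size vs = size zs ->
    exists2 f : {mpoly F[n.+1]}, f \is t.-homog &
      forall k, (k < size zs)%N -> evalp f (nth 0 zs k) = nth 0 vs k.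

End Geometry.

(* Main.v *)
(* In suitable coordinates the equation of the quadric is
   q = 2 x_0 x_1 + \sum_(i >= 2) c_i x_i^2, and the monomials not divisible by x_0 x_1
   are a basis of the forms modulo q. If a is on the quadric and o is off it, the line
   joining them meets the quadric again in the mirror image of a with respect to o;
   hence chains of d lines with their 2d points on the quadric form a family
   parametrized by an affine space. Every property required of the bamboo is the
   nonvanishing of a polynomial in the parameters, and for t >= d surjectivity in
   degree t implies surjectivity in degree t + 1. So it is enough to find, for each
   property, one possibly degenerate chain that has it.

   For the maximal rank in degree t + 1 one specializes to the hyperplane H on which the
   last coordinate x vanishes. Points off H that are independent in degree t, together
   with points of H that are independent in degree t + 1, are independent in
   degree t + 1: multiply by x. A chain with points off H and a chain in H are joined
   by moving a node of the first one to a node of the second one with reflections, and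
   they are completed by lines with one point in H and the other one off H. With
   h(n, t + 1) = h(n - 1, t + 1) + h(n, t) this gives, by induction on n and t,
   h(n, t) / 2 lines with independent points whenever t >= 2. In degree 1 one takes n
   lines through a common point, which explains the hypothesis d >= n. *)
Require Import Defs.
From HB Require Import structures.
From mathcomp Require Import all_boot all_order all_algebra.
From mathcomp Require Import mpoly.
From mathcomp Require Import ring zify.

Set Implicit Arguments.
Unset Strict Implicit.
Unset Printing Implicit Defensive.

Import Order.TTheory GRing.Theory Num.Theory.
Local Open Scope ring_scope.

(** Lines bring their points two at a time, while the specialization to H splits the conditions into
    h(n - 1, t + 1) inside H and h(n, t) outside. When both numbers are odd, one condition stays
    open on each side, and a mixed line, with one point on each side, closes both at once. Degree 1
    cannot feed the induction: two meeting lines lie in a plane, so their four points are dependent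
    in degree 1. The induction therefore starts in degree 2 with a single line off H, and mixed
    lines supply the remaining linear conditions. Degenerate chains may repeat lines. If injectivity
    is the goal, a chain that is too short is thus lengthened by copies of one of its lines, at no
    cost. Only finitely many open conditions can be imposed together, so genericity is used for t <=
    d only. In degree d there are more than 2d independent forms modulo q, which excludes
    injectivity and leaves surjectivity to propagate to all higher degrees. *)

(** * Functions that are polynomial along lines, and their common nonvanishing *)

Section PolynomialFunctions.
Variable F : closedFieldType.

(* Being polynomial along every affine line is all that is needed to make finitely
   many nonvanishing conditions hold at a common point. *)
Definition polyfun (V : lmodType F) (g : V -> F) :=
  forall u v, exists p : {poly F}, forall s, g (u + s *: v) = p.[s].

Definition polyvec (V : lmodType F) n (f : V -> 'rV[F]_n) :=
  forall i, polyfun (fun x => f x 0 i).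

Section Closure.
Variable V : lmodType F.
Implicit Types f g : V -> F.

Lemma polyfun_ext f g : f =1 g -> polyfun f -> polyfun g.
Proof. by move=> fg pf u v; have [p Hp] := pf u v; exists p => s; rewrite -fg. Qed.

Lemma polyfun_cst c : polyfun (fun _ : V => c).
Proof. by move=> u v; exists c%:P => s; rewrite hornerC. Qed.

Lemma polyfunD f g : polyfun f -> polyfun g -> polyfun (fun x => f x + g x).
Proof.
move=> pf pg u v; have [p Hp] := pf u v; have [r Hr] := pg u v.
by exists (p + r) => s; rewrite hornerD Hp Hr.
Qed.

Lemma polyfunM f g : polyfun f -> polyfun g -> polyfun (fun x => f x * g x).
Proof.
move=> pf pg u v; have [p Hp] := pf u v; have [r Hr] := pg u v.
by exists (p * r) => s; rewrite hornerM Hp Hr.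
Qed.

Lemma polyfun_sum I (r : seq I) (P : pred I) (f : I -> V -> F) :
  (forall i, polyfun (f i)) -> polyfun (fun x => \sum_(i <- r | P i) f i x).
Proof.
move=> pf; elim: r => [|i r IH].
  by apply: (polyfun_ext _ (polyfun_cst 0)) => x; rewrite big_nil.
case Pi : (P i).
  by apply: (polyfun_ext _ (polyfunD (pf i) IH)) => x; rewrite big_cons Pi.
by apply: (polyfun_ext _ IH) => x; rewrite big_cons Pi.
Qed.

Lemma polyfun_prod I (r : seq I) (P : pred I) (f : I -> V -> F) :
  (forall i, polyfun (f i)) -> polyfun (fun x => \prod_(i <- r | P i) f i x).
Proof.
move=> pf; elim: r => [|i r IH].
  by apply: (polyfun_ext _ (polyfun_cst 1)) => x; rewrite big_nil.
case Pi : (P i).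
  by apply: (polyfun_ext _ (polyfunM (pf i) IH)) => x; rewrite big_cons Pi.
by apply: (polyfun_ext _ IH) => x; rewrite big_cons Pi.
Qed.

Lemma polyfun_det n (M : V -> 'M[F]_n) :
  (forall i j, polyfun (fun x => M x i j)) -> polyfun (fun x => \det (M x)).
Proof.
move=> pM; apply: polyfun_sum => s; apply: polyfunM; first exact: polyfun_cst.
exact: polyfun_prod.
Qed.

Lemma polyfun_linear f :
  (forall s u v, f (u + s *: v) = f u + s * f v) -> polyfun f.
Proof.
move=> lf u v; exists ((f u)%:P + 'X * (f v)%:P) => s.
by rewrite hornerD hornerM hornerX !hornerC lf.
Qed.

(** On the line joining [u] and [v] both functions become nonzero polynomials in one variable, and
    over an algebraically closed field their product has a nonroot. *)
Lemma polyfun_common f g u v : polyfun f -> polyfun g -> f u != 0 -> g v != 0 ->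
  exists w, f w * g w != 0.
Proof.
move=> pf pg fu gv.
have [p Hp] := pf u (v - u); have [r Hr] := pg u (v - u).
have p0 : p != 0.
  by apply: contraNneq fu => p0; have := Hp 0; rewrite p0 horner0 scale0r addr0 => ->.
have r0 : r != 0.
  apply: contraNneq gv => r0; have := Hr 1.
  by rewrite r0 horner0 scale1r addrC subrK => ->.
have /closed_nonrootP[s] : p * r != 0 by rewrite mulf_neq0.
by rewrite /root hornerM -Hp -Hr; exists (u + s *: (v - u)).
Qed.

Lemma polyfun_common_seq (I : eqType) (r : seq I) (f : I -> V -> F) :
  (forall i, i \in r -> polyfun (f i)) ->
  (forall i, i \in r -> exists u, f i u != 0) ->
  exists w, forall i, i \in r -> f i w != 0.
Proof.
move=> pf nf.
suff [w Hw] : exists w, \prod_(i <- r) f i w != 0.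
  by exists w => i ir; move: Hw; rewrite prodf_seq_neq0 => /allP/(_ i ir).
have: polyfun (fun x => \prod_(i <- r) f i x) /\ exists w, \prod_(i <- r) f i w != 0.
  elim: r pf nf => [|i r IH] pf nf.
    split; last by exists 0; rewrite big_nil oner_neq0.
    by apply: (polyfun_ext _ (polyfun_cst 1)) => x; rewrite big_nil.
  have [||pr [v Hv]] := IH.
  - by move=> j jr; apply: pf; rewrite inE jr orbT.
  - by move=> j jr; apply: nf; rewrite inE jr orbT.
  have pi := pf i (mem_head _ _).
  have [u Hu] := nf i (mem_head _ _).
  split; first by apply: (polyfun_ext _ (polyfunM pi pr)) => x; rewrite big_cons.
  by have [w Hw] := polyfun_common pi pr Hu Hv; exists w; rewrite big_cons.
by case.
Qed.

End Closure.
End PolynomialFunctions.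

(** * Homogeneous forms as functions *)

Section Forms.
Variables (F : closedFieldType) (n : nat).
Local Notation vec := 'rV[F]_(n.+1).

Definition lin (l : vec -> F) := exists w : 'cV[F]_(n.+1), forall v, l v = (v *m w) 0 0.

(** Forms are kept as functions, so that composing them with reflections is immediate; [form_mpoly]
    turns them back into polynomials. The pointwise equations in the constructors avoid functional
    extensionality. *)
Inductive pform : nat -> (vec -> F) -> Prop :=
| form_cst c f : (forall v, f v = c) -> pform 0 f
| form_add t f g h :
    pform t f -> pform t g -> (forall v, h v = f v + g v) -> pform t h
| form_mul t l f h :
    lin l -> pform t f -> (forall v, h v = l v * f v) -> pform t.+1 h.

Lemma linD l : lin l -> forall u v, l (u + v) = l u + l v.
Proof. by case=> w Hw u v; rewrite !Hw mulmxDl mxE. Qed.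

Lemma linZ l : lin l -> forall c v, l (c *: v) = c * l v.
Proof. by case=> w Hw c v; rewrite !Hw -scalemxAl mxE. Qed.

Lemma lin_scale l c : lin l -> lin (fun v => c * l v).
Proof. by case=> w Hw; exists (c *: w) => v; rewrite Hw -scalemxAr [RHS]mxE. Qed.

Lemma lin_add l m : lin l -> lin m -> lin (fun v => l v + m v).
Proof. by case=> w Hw [z Hz]; exists (w + z) => v; rewrite Hw Hz mulmxDr [RHS]mxE. Qed.

Lemma form_ext t f g : (forall v, g v = f v) -> pform t f -> pform t g.
Proof.
move=> Hg Hf; elim: Hf g Hg => {t f}.
- by move=> c f Hf g Hg; apply: (@form_cst c) => v; rewrite Hg Hf.
- by move=> t f g h Hf _ Hg _ Hh k Hk; apply: (form_add Hf Hg) => v; rewrite Hk.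
by move=> t l f h Hl Hf _ Hh k Hk; apply: (form_mul Hl Hf) => v; rewrite Hk.
Qed.

Lemma form_scale t f c : pform t f -> pform t (fun v => c * f v).
Proof.
elim=> {t f}.
- by move=> d f Hf; apply: (@form_cst (c * d)) => v; rewrite Hf.
- by move=> t f g h _ Hf _ Hg Hh; apply: (form_add Hf Hg) => v; rewrite Hh mulrDr.
by move=> t l f h Hl _ Hf Hh; apply: (form_mul Hl Hf) => v; rewrite Hh mulrCA.
Qed.

Lemma form_zero t : pform t (fun=> 0).
Proof.
elim: t => [|t IH]; first exact: (@form_cst 0).
apply: (@form_mul t (fun=> 0) _ _ _ IH) => [|v]; last by rewrite mul0r.
by exists 0 => v; rewrite mulmx0 mxE.
Qed.

Lemma formD t f g : pform t f -> pform t g -> pform t (fun v => f v + g v).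
Proof. by move=> Hf Hg; apply: (form_add Hf Hg). Qed.

Lemma form_lin l : lin l -> pform 1 l.
Proof.
move=> Hl; apply: (@form_mul 0 l (fun=> 1) _ Hl); last by move=> v; rewrite mulr1.
exact: (@form_cst 1).
Qed.

Lemma form_homog t f : pform t f -> forall c v, f (c *: v) = c ^+ t * f v.
Proof.
elim=> {t f}.
- by move=> d f Hf c v; rewrite !Hf expr0 mul1r.
- by move=> t f g h _ Hf _ Hg Hh c v; rewrite !Hh Hf Hg mulrDr.
by move=> t l f h Hl _ Hf Hh c v; rewrite !Hh Hf (linZ Hl) exprS mulrACA.
Qed.

Lemma formM t s f g : pform t f -> pform s g -> pform (t + s) (fun v => f v * g v).
Proof.
move=> Hf Hg; elim: Hf => {t f}.
- by move=> c f Hf; apply: form_ext (form_scale c Hg) => v; rewrite Hf.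
- by move=> t f h k _ Hf _ Hh Hk; apply: (form_add Hf Hh) => v; rewrite Hk mulrDl.
by move=> t l f h Hl _ Hf Hh; apply: (form_mul Hl Hf) => v; rewrite Hh mulrA.
Qed.

Lemma formX t (l : vec -> F) : lin l -> pform t (fun v => l v ^+ t).
Proof.
move=> Hl; elim: t => [|t IH]; first exact: (@form_cst 1).
by apply: (form_mul Hl IH) => v; rewrite exprS.
Qed.

Lemma form_mulmx t f (M : 'M[F]_(n.+1)) : pform t f -> pform t (fun v => f (v *m M)).
Proof.
elim=> {t f}.
- by move=> d f Hf; apply: (@form_cst d).
- by move=> t f g h _ Hf _ Hg Hh; apply: (form_add Hf Hg).
move=> t l f h [w Hw] _ Hf Hh; apply: (@form_mul t (fun v => l (v *m M)) _ _ _ Hf) => //.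
by exists (M *m w) => v; rewrite Hw mulmxA.
Qed.

Lemma form_mpoly t f : pform t f ->
  exists2 p : {mpoly F[n.+1]}, p \is t.-homog & forall v, evalp p v = f v.
Proof.
elim=> {t f}.
- move=> d f Hf; exists d%:MP => [|v]; last by rewrite Hf /evalp mevalC.
  by rewrite -[d]mulr1 mpolyCM mul_mpolyC dhomogZ ?dhomog1.
- move=> t f g h _ [p Hp pE] _ [r Hr rE] Hh; exists (p + r); first exact: dhomogD.
  by move=> v; rewrite /evalp mevalD Hh -pE -rE.
move=> t l f h [w Hw] _ [p Hp pE] Hh.
exists ((\sum_i w i 0 *: 'X_i) * p) => [|v].
  apply: (@dhomogM _ _ _ 1%N) => //; apply: rpred_sum => i _.
  by apply: dhomogZ; rewrite dhomogX; apply/eqP; apply: mdeg1.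
rewrite /evalp mevalM Hh -pE raddf_sum Hw mxE; congr (_ * _).
by apply: eq_bigr => i _; rewrite /= mevalZ mevalXU mulrC.
Qed.

Lemma form_polyfun t f (V : lmodType F) (g : V -> vec) :
  pform t f -> polyvec g -> polyfun (fun x => f (g x)).
Proof.
move=> Hf pg; elim: Hf => {t f}.
- by move=> d f Hf; apply: polyfun_ext _ (@polyfun_cst F V d) => x; rewrite Hf.
- by move=> t f k h _ Hf _ Hk Hh; apply: polyfun_ext _ (polyfunD Hf Hk) => x; rewrite Hh.
move=> t l f h [w Hw] _ Hf Hh.
have Hl : polyfun (fun x => l (g x)).
  apply: (@polyfun_ext _ _ (fun x => \sum_i g x 0 i * w i 0)).
    by move=> x; rewrite Hw mxE.
  by apply: polyfun_sum => i; apply: polyfunM => //; apply: polyfun_cst.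
by apply: polyfun_ext _ (polyfunM Hl Hf) => x; rewrite Hh.
Qed.

End Forms.

(* In the basis [eb] the quadratic form is [2 x_0 x_1 + \sum_(i >= 2) c_i x_i ^ 2]. *)
Record frame (F : closedFieldType) (n : nat) (A : 'M[F]_(n.+1)) := Frame {
  co : nat -> 'rV[F]_(n.+1) -> F;
  eb : nat -> 'rV[F]_(n.+1);
  cc : nat -> F;
  two_neq0 : (2 : F) != 0;
  frame_dim : (3 <= n)%N;
  co_lin : forall i, lin (co i);
  co_eb : forall i j, (i < n.+1)%N -> (j < n.+1)%N -> co i (eb j) = (i == j)%:R;
  vec_eb : forall v, v = \sum_(i < n.+1) co i v *: eb i;
  cc01 : forall i, cc i = 0 \/ cc i = 1;
  cc2 : cc 2 = 1;
  cc3 : cc 3 = 1;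
  polC : forall x y, qpolar A x y = qpolar A y x;
  pol_eb0 : forall x, qpolar A x (eb 0) = co 1 x;
  pol_eb1 : forall x, qpolar A x (eb 1) = co 0 x;
  pol_eb : forall i x, (2 <= i < n.+1)%N -> qpolar A x (eb i) = cc i * co i x }.

(** * Reflections and the points of the quadric *)

Section Reflections.
Variables (F : closedFieldType) (n : nat) (A : 'M[F]_(n.+1)) (fr : frame A).
Local Notation vec := 'rV[F]_(n.+1).
Local Notation B := (qpolar A).
Local Notation q := (qform A).
Local Notation co := (co fr).
Local Notation eb := (eb fr).
Local Notation cc := (cc fr).

Lemma polDl x y z : B (x + y) z = B x z + B y z.
Proof. by rewrite /qpolar !mulmxDl mxE. Qed.

Lemma polZl c x z : B (c *: x) z = c * B x z.
Proof. by rewrite /qpolar -!scalemxAl mxE. Qed.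

Lemma polDr x y z : B z (x + y) = B z x + B z y.
Proof. by rewrite polC // polDl !(polC fr z). Qed.

Lemma polZr c x z : B z (c *: x) = c * B z x.
Proof. by rewrite (polC fr) polZl (polC fr z). Qed.

Lemma polNl x z : B (- x) z = - B x z.
Proof. by rewrite -scaleN1r polZl mulN1r. Qed.

Lemma polNr x z : B z (- x) = - B z x.
Proof. by rewrite -scaleN1r polZr mulN1r. Qed.

Definition polE := (polDl, polDr, polZl, polZr, polNl, polNr).

Lemma pol_lin y : lin (fun x => B x y).
Proof. by exists (A *m y^T) => v; rewrite /qpolar mulmxA. Qed.

Lemma qE x : q x = B x x. Proof. by []. Qed.

(* The reflection in the hyperplane orthogonal to [o], multiplied by [q o]. *)
Definition refl (o x : vec) : vec := q o *: x - (2 * B x o) *: o.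

Lemma refl_mulmx o : exists M, forall x, refl o x = x *m M.
Proof.
exists ((q o)%:M - 2 *: (A *m o^T *m o)) => x.
rewrite mulmxBr mul_mx_scalar -scalemxAr /refl; congr (_ - _).
rewrite !mulmxA [x *m A *m o^T]mx11_scalar mul_scalar_mx scalerA; congr (_ *: _).
Qed.

Lemma pol_refl o x y : B (refl o x) (refl o y) = q o ^+ 2 * B x y.
Proof. by rewrite /refl !polE !qE (polC fr o y); ring. Qed.

Lemma qform_refl o x : q (refl o x) = q o ^+ 2 * q x.
Proof. exact: pol_refl. Qed.

Lemma pol_refl_axis o x : B (refl o x) o = - (q o * B x o).
Proof. by rewrite /refl !polE -qE; ring. Qed.

Lemma reflK o x : refl o (refl o x) = q o ^+ 2 *: x.
Proof. by rewrite {1}/refl pol_refl_axis /refl; apply/rowP => i; rewrite !mxE; ring. Qed.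

Lemma form_refl t f o : pform t f -> pform t (fun v => f (refl o v)).
Proof.
by move=> Hf; have [M HM] := refl_mulmx o; apply: form_ext (form_mulmx M Hf) => v; rewrite HM.
Qed.

Section PolyvecClosure.
Variable V : lmodType F.
Implicit Types f g : V -> vec.

Lemma polyvecD f g : polyvec f -> polyvec g -> polyvec (fun x => f x + g x).
Proof.
by move=> pf pg i; apply: polyfun_ext _ (polyfunD (pf i) (pg i)) => x; rewrite mxE.
Qed.

Lemma polyvecZ (c : V -> F) f : polyfun c -> polyvec f -> polyvec (fun x => c x *: f x).
Proof.
by move=> pc pf i; apply: polyfun_ext _ (polyfunM pc (pf i)) => x; rewrite mxE.
Qed.

Lemma polyvec_linear f :
  (forall s u v, f (u + s *: v) = f u + s *: f v) -> polyvec f.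
Proof. by move=> lf i; apply: polyfun_linear => s u v; rewrite lf !mxE. Qed.

Lemma polyvec_cst (v : vec) : polyvec (fun _ : V => v).
Proof. by move=> i; apply: polyfun_cst. Qed.

Lemma polyfun_pol f g : polyvec f -> polyvec g -> polyfun (fun x => B (f x) (g x)).
Proof.
move=> pf pg.
apply: (@polyfun_ext _ _ (fun x => \sum_j (\sum_i f x 0 i * A i j) * g x 0 j)).
  by move=> x; rewrite /qpolar mxE; apply: eq_bigr => j _; rewrite !mxE.
apply: polyfun_sum => j; apply: polyfunM => //; apply: polyfun_sum => i.
by apply: polyfunM => //; apply: polyfun_cst.
Qed.

Lemma polyvec_refl f g : polyvec f -> polyvec g -> polyvec (fun x => refl (f x) (g x)).
Proof.
move=> pf pg; apply: polyvecD; first by apply: polyvecZ => //; apply: polyfun_pol.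
apply: (_ : polyvec (fun x => - _)) => i.
have pfg : polyfun (fun x => - (2 * B (g x) (f x))).
  apply: (@polyfun_ext _ _ (fun x => (- 2) * B (g x) (f x))).
    by move=> x; rewrite mulNr.
  by apply: polyfunM; [apply: polyfun_cst | apply: polyfun_pol].
by apply: polyfun_ext _ (polyvecZ pfg pf i) => x; rewrite scaleNr.
Qed.

End PolyvecClosure.

(** The coordinate subspace P^(k+1), indexed by the dimension [k] of its quadric section: two points
    for [k = 0], a conic for [k = 1], all of W for [k = n.-1]. The hyperplane H of a degeneration is
    [flag k] inside [flag k.+1], with equation [co k.+2 = 0]. *)
Definition flag (k : nat) (v : vec) := forall i, (k.+1 < i < n.+1)%N -> co i v = 0.

Lemma flagD k u v : flag k u -> flag k v -> flag k (u + v).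
Proof. by move=> Hu Hv i Hi; rewrite (linD (co_lin fr i)) Hu // Hv // addr0. Qed.

Lemma flagZ k c v : flag k v -> flag k (c *: v).
Proof. by move=> Hv i Hi; rewrite (linZ (co_lin fr i)) Hv // mulr0. Qed.

Lemma flag_refl k o v : flag k o -> flag k v -> flag k (refl o v).
Proof.
by move=> Ho Hv; apply: flagD; [apply: flagZ | rewrite -scaleNr; apply: flagZ].
Qed.

Lemma flag_eb k i : (i <= k.+1)%N -> (k.+1 < n.+1)%N -> flag k (eb i).
Proof. by move=> Hi Hk j Hj; rewrite co_eb; [case: eqP => // ?; exfalso; lia|lia|lia]. Qed.

Lemma flag_le k l v : (k <= l)%N -> flag k v -> flag l v.
Proof. by move=> kl Hv i Hi; apply: Hv; lia. Qed.

Lemma flag_last k v : (k.+2 < n.+1)%N -> flag k.+1 v -> co k.+2 v = 0 -> flag k v.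
Proof.
move=> Hk Hv H0 i Hi; have [->//|Hik] := eqVneq i k.+2; apply: Hv; lia.
Qed.

(** Projection onto [flag k]; it lets parameters for vectors of the flag range over the whole
    space. *)
Definition trunc (k : nat) (v : vec) : vec :=
  \sum_(i < n.+1 | (i <= k.+1)%N) co i v *: eb i.

Lemma co0 i : co i 0 = 0.
Proof. by rewrite -(scale0r (0 : vec)) (linZ (co_lin fr i)) mul0r. Qed.

Lemma flag_trunc k v : flag k (trunc k v).
Proof.
move=> j Hj; rewrite /trunc; elim/big_ind: _ => [|x y Hx Hy|i Hi]; first exact: co0.
  by rewrite (linD (co_lin fr j)) Hx Hy addr0.
rewrite (linZ (co_lin fr j)) co_eb; [|lia|exact: ltn_ord].
case: eqP => [?|_]; [exfalso; lia | by rewrite mulr0].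
Qed.

Lemma trunc_id k v : flag k v -> trunc k v = v.
Proof.
move=> Hv; rewrite [RHS](vec_eb fr) /trunc big_mkcond; apply: eq_bigr => i _.
by case: leqP => // Hi; rewrite Hv ?scale0r //; rewrite Hi ltn_ord.
Qed.

Lemma trunc_linear k s u v : trunc k (u + s *: v) = trunc k u + s *: trunc k v.
Proof.
rewrite /trunc scaler_sumr -big_split; apply: eq_bigr => i _ /=.
by rewrite (linD (co_lin fr i)) (linZ (co_lin fr i)) scalerDl scalerA.
Qed.

(* The point [a] is required to be off the vertex of the quadric, so that it can be
   reached by reflections. *)
Definition nonvanishing k (f : vec -> F) :=
  exists a u, [/\ flag k a, flag k u, q a = 0, B a u != 0 & f a != 0].

Lemma n_gt1 : (1 < n.+1)%N. Proof. by have := frame_dim fr; lia. Qed.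
Lemma n_gt2 : (2 < n.+1)%N. Proof. by have := frame_dim fr; lia. Qed.
Lemma q_eb0 : q (eb 0) = 0.
Proof. by rewrite qE pol_eb0 co_eb // n_gt1. Qed.
Lemma q_eb1 : q (eb 1) = 0.
Proof. by rewrite qE pol_eb1 co_eb // n_gt1. Qed.
Lemma pol_eb01 : B (eb 0) (eb 1) = 1.
Proof. by rewrite pol_eb1 co_eb. Qed.
Lemma q_eb2 : q (eb 2) = 1.
Proof. by rewrite qE pol_eb ?n_gt2 // co_eb ?n_gt2 // cc2 mul1r. Qed.

(** For isotropic [a] the scaled reflection [refl a] degenerates: it sends every [x] to a multiple
    of [a], nonzero as soon as [x] is not orthogonal to [a]. So [y] can be [a] itself, and [z] only
    has to move [eb 0] out of the orthogonal of [a]. *)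
Lemma refl_reach k a u : (0 < k)%N -> (k < n)%N -> flag k a -> flag k u ->
  q a = 0 -> B a u != 0 ->
  exists y z c, [/\ flag k y, flag k z, c != 0 & refl y (refl z (eb 0)) = c *: a].
Proof.
move=> k0 kn Ha Hu qa Bau.
have Hred z : B (refl z (eb 0)) a != 0 -> flag k z -> exists y z c,
    [/\ flag k y, flag k z, c != 0 & refl y (refl z (eb 0)) = c *: a].
  move=> Hz fz; exists a, z, (- (2 * B (refl z (eb 0)) a)); split=> //.
    by rewrite oppr_eq0 mulf_neq0 // (two_neq0 fr).
  by rewrite {1}/refl qa scale0r add0r scaleNr.
have fl i : (i <= k.+1)%N -> flag k (eb i) by move=> Hi; apply: flag_eb; lia.
have [Bea|Bea] := eqVneq (B (eb 0) a) 0; last first.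
  (* [eb 2] has norm 1 and is orthogonal to [eb 0], so this reflection leaves [eb 0] in place. *)
  apply: (Hred (eb 2)); last by apply: fl; lia.
  rewrite /refl q_eb2 scale1r pol_eb ?n_gt2 // co_eb ?n_gt2 // mulr0 mulr0 scale0r subr0.
  exact: Bea.
have Hz z : flag k z -> B (eb 0) z != 0 -> B z a != 0 -> exists y z c,
    [/\ flag k y, flag k z, c != 0 & refl y (refl z (eb 0)) = c *: a].
  move=> fz Bez Bza; apply: (Hred z) => //.
  rewrite /refl !polE Bea mulr0 add0r oppr_eq0 !mulf_neq0 //; exact: (two_neq0 fr).
have f1 : flag k (eb 1) by apply: fl; lia.
(* The axis must be orthogonal neither to [eb 0] nor to [a]. The first holds for [eb 1] and the
   second for [u]; one of [eb 1], [u] and [u + eb 1] satisfies both. *)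
have [B1a|B1a] := eqVneq (B (eb 1) a) 0; last first.
  by apply: (Hz (eb 1)) => //; rewrite pol_eb01 oner_neq0.
have Bua : B u a != 0 by rewrite (polC fr).
have [Beu|Beu] := eqVneq (B (eb 0) u) 0; last exact: (Hz u).
apply: (Hz (u + eb 1)); first exact: flagD.
  by rewrite polDr Beu pol_eb01 add0r oner_neq0.
by rewrite polDl B1a addr0.
Qed.

(** Irreducibility of the quadric section, read off from its parametrization by pairs of axes. It
    needs [0 < k], since for [k = 0] the section consists of two points. *)
Lemma nonvanishingM k t s f g : (0 < k)%N -> (k < n)%N -> pform t f -> pform s g ->
  nonvanishing k f -> nonvanishing k g -> nonvanishing k (fun v => f v * g v).
Proof.
move=> k0 kn Hf Hg [a [u [fa fu qa Bau fa0]]] [b [w [fb fw qb Bbw gb0]]].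
pose Phi (x : vec * vec) := refl (trunc k x.1) (refl (trunc k x.2) (eb 0)).
have pPhi : polyvec Phi.
  apply: polyvec_refl; first by apply: polyvec_linear => c x y; rewrite /= trunc_linear.
  apply: polyvec_refl; first by apply: polyvec_linear => c x y; rewrite /= trunc_linear.
  exact: polyvec_cst.
have reach c d : flag k c -> flag k d -> q c = 0 -> B c d != 0 ->
    exists x s, s != 0 /\ Phi x = s *: c.
  move=> fc fd qc Bcd; have [y [z [e [fy fz e0 He]]]] := refl_reach k0 kn fc fd qc Bcd.
  by exists (y, z), e; rewrite /Phi /= !trunc_id.
have [x1 [s1 [s10 Hx1]]] := reach a u fa fu qa Bau.
have [x2 [s2 [s20 Hx2]]] := reach b w fb fw qb Bbw.
(* The extra factor keeps the common point off the vertex. *)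
have p1 : polyfun (fun x => f (Phi x) * B (Phi x) u).
  apply: polyfunM; first exact: form_polyfun Hf pPhi.
  by apply: polyfun_pol => //; apply: polyvec_cst.
have p2 : polyfun (fun x => g (Phi x)) by apply: form_polyfun Hg pPhi.
have [||x Hx] := polyfun_common p1 p2 (u := x1) (v := x2).
- by rewrite Hx1 (form_homog Hf) polZl !mulf_neq0 // expf_neq0.
- by rewrite Hx2 (form_homog Hg) mulf_neq0 // expf_neq0.
exists (Phi x), u; move: Hx; rewrite !mulf_eq0 !negb_or => /andP[/andP[-> ->] ->].
split=> //; last by rewrite !qform_refl q_eb0 !mulr0.
apply: flag_refl; first exact: flag_trunc.
by apply: flag_refl; [exact: flag_trunc | apply: flag_eb; lia].
Qed.

End Reflections.

(* Lists of variables of the monomials of degree [t] in the variables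
   [0 .. k.+1] that are not divisible by [x_0 x_1]: as [q] contains [2 x_0 x_1],
   they represent a basis of the degree [t] forms modulo [q]. *)
Fixpoint words (k t : nat) : seq (seq nat) :=
  match k with
  | 0 => if t is 0 then [:: [::]] else [:: nseq t 0%N; nseq t 1%N]
  | k'.+1 => (fix words_k t := if t is t'.+1 then
        words k' t'.+1 ++ map (cons k'.+2) (words_k t')
      else [:: [::]]) t
  end.

Lemma wordsS k t :
  words k.+1 t.+1 = words k t.+1 ++ map (cons k.+2) (words k.+1 t).
Proof. by []. Qed.

Lemma words0S t : words 0 t.+1 = [:: nseq t.+1 0%N; nseq t.+1 1%N].
Proof. by []. Qed.

Lemma words0 k : words k 0 = [:: [::]]. Proof. by case: k. Qed.

Lemma size_words k t w : w \in words k t -> size w = t.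
Proof.
elim: k t w => [|k IHk] t w.
  case: t => [|t]; rewrite !inE; first by move/eqP->.
  by case/orP => /eqP->; rewrite /= size_nseq.
elim: t w => [|t IHt] w; first by rewrite inE => /eqP->.
by rewrite wordsS mem_cat => /orP[/IHk//|/mapP[w' /IHt Hw' ->]]; rewrite /= Hw'.
Qed.

Lemma words_perm k t w : size w = t -> all (fun i => i <= k.+1)%N w ->
  ~~ ((0%N \in w) && (1%N \in w)) -> exists2 w', w' \in words k t & perm_eq w w'.
Proof.
elim: k t w => [|k IHk] t w.
  case: t => [|t] sw aw nw; first by exists w; rewrite // inE -size_eq0 sw.
  suff [ew|ew] : w = nseq t.+1 0%N \/ w = nseq t.+1 1%N.
  - by exists w; rewrite // !inE ew eqxx.
  - by exists w; rewrite // !inE ew eqxx orbT.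
  have [w0|w0] := boolP (0%N \in w).
    left; rewrite -sw; apply/all_pred1P/allP => i iw /=.
    have := allP aw _ iw; move: nw iw; rewrite w0 /=.
    by case: i => [|[|i]] //= /negPf->.
  right; rewrite -sw; apply/all_pred1P/allP => i iw /=.
  by have := allP aw _ iw; move: w0 iw; case: i => [|[|i]] //= /negPf->.
elim: t w => [|t IHt] w sw aw nw.
  by exists w; rewrite // inE -size_eq0 sw.
have [kw|kw] := boolP (k.+2 \in w).
  have pw := perm_to_rem kw.
  have [||| w' Hw' pw'] := IHt (rem k.+2 w).
  - by rewrite size_rem // sw.
  - by apply/allP => i /mem_rem; apply: (allP aw).
  - by apply: contraNN nw => /andP[/mem_rem-> /mem_rem->].
  exists (k.+2 :: w'); first by rewrite wordsS mem_cat map_f ?orbT.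
  by apply: perm_trans pw _; rewrite perm_cons.
have [|w' Hw' pw'] := IHk t.+1 w sw _ nw.
  apply/allP => i iw; have := allP aw _ iw; rewrite leq_eqVlt ltnS.
  by case/orP => [/eqP ik|//]; rewrite ik (negPf kw) in iw.
by exists w'; rewrite // wordsS mem_cat Hw'.
Qed.

(** * Monomials as a basis of the forms on the quadric *)

Section Words.
Variables (F : closedFieldType) (n : nat) (A : 'M[F]_(n.+1)) (fr : frame A).
Local Notation vec := 'rV[F]_(n.+1).
Local Notation B := (qpolar A).
Local Notation q := (qform A).
Local Notation co := (co fr).
Local Notation eb := (eb fr).
Local Notation cc := (cc fr).

Definition monom (w : seq nat) (v : vec) : F := \prod_(i <- w) co i v.

Definition lcomb (ws : seq (seq nat)) (c : nat -> F) (v : vec) : F :=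
  \sum_(0 <= i < size ws) c i * monom (nth [::] ws i) v.

Lemma monom_nseq t i v : monom (nseq t i) v = co i v ^+ t.
Proof.
rewrite /monom; elim: t => [|t IH]; first by rewrite big_nil.
by rewrite /= big_cons IH exprS.
Qed.

Lemma form_monom w : pform (size w) (monom w).
Proof.
rewrite /monom; elim: w => [|i w IH]; first by apply: (@form_cst _ _ 1) => v; rewrite big_nil.
by apply: (form_mul (co_lin fr i) IH) => v; rewrite big_cons.
Qed.

Lemma form_lcomb k t c : pform t (lcomb (words k t) c).
Proof.
suff H ws : {subset ws <= words k t} -> pform t (lcomb ws c) by apply: H.
move=> Hws; rewrite /lcomb.
suff H m : (m <= size ws)%N ->
    pform t (fun v => \sum_(0 <= i < m) c i * monom (nth [::] ws i) v) by apply: H.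
elim: m => [|m IH] Hm.
  by apply: form_ext (form_zero F n t) => v; rewrite big_geq.
have Hf := form_monom (nth [::] ws m).
rewrite (size_words (Hws _ (mem_nth _ Hm))) in Hf.
by apply: form_add (IH (ltnW Hm)) (form_scale (c m) Hf) _ => v; rewrite big_nat_recr.
Qed.

Lemma lcomb_cat ws us c v : lcomb (ws ++ us) c v =
  lcomb ws c v + lcomb us (fun i => c (size ws + i)%N) v.
Proof.
rewrite /lcomb size_cat (big_cat_nat _ (n := size ws)) ?leq_addr //=; congr (_ + _).
  by rewrite !big_nat; apply: eq_bigr => i /andP[_ Hi]; rewrite nth_cat Hi.
rewrite -{1}[size ws]add0n big_addn addKn; apply: eq_bigr => i _.
by rewrite nth_cat ltnNge leq_addl /= addnK addnC.
Qed.

Lemma lcomb_cons k ws c v :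
  lcomb (map (cons k) ws) c v = co k v * lcomb ws c v.
Proof.
rewrite /lcomb size_map mulr_sumr !big_nat; apply: eq_bigr => i /andP[_ Hi].
by rewrite (nth_map [::]) // /monom big_cons; ring.
Qed.

Lemma lcomb2 w1 w2 c v :
  lcomb [:: w1; w2] c v = c 0%N * monom w1 v + c 1%N * monom w2 v.
Proof. by rewrite /lcomb big_nat_recl // big_nat1. Qed.

(** For [s = 1] and [s = -1] an isotropic vector with nonzero coordinate [i], whether [cc i] is 0 or
    1; its product 1 with [eb 1] keeps it off the vertex. *)
Definition spike i (s : F) : vec := eb 0 - (2 * cc i) *: eb 1 + (2 * s) *: eb i.

Lemma spikeP i s : (2 <= i < n.+1)%N -> s ^+ 2 = 1 ->
  [/\ q (spike i s) = 0, B (spike i s) (eb 1) = 1,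
      B (spike i s) (eb 0) = - (2 * cc i), co i (spike i s) = 2 * s &
      flag fr i.-1 (spike i s)].
Proof.
move=> Hi s2; have n1 := n_gt1 fr; have Hi' : (i < n.+1)%N by lia.
have co_spike j : (j < n.+1)%N -> co j (spike i s) =
    (j == 0)%:R - 2 * cc i * (j == 1)%:R + 2 * s * (j == i)%:R.
  move=> Hj; rewrite /spike -scaleNr !(linD (co_lin fr j), linZ (co_lin fr j)).
  by rewrite !co_eb // mulNr.
have B0 : B (spike i s) (eb 0) = - (2 * cc i).
  rewrite pol_eb0 co_spike // (_ : (1 == i)%N = false) /=; last by case: eqP => // ?; exfalso; lia.
  by rewrite !mulr0 mulr1 addr0 add0r.
have B1 : B (spike i s) (eb 1) = 1.
  rewrite pol_eb1 co_spike // (_ : (0 == i)%N = false) /=; last by case: eqP => // ?; exfalso; lia.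
  by rewrite !mulr0 subr0 addr0.
have Ci : co i (spike i s) = 2 * s.
  rewrite co_spike // eqxx (_ : (i == 0)%N = false) /=; last by case: eqP => // ?; exfalso; lia.
  rewrite (_ : (i == 1)%N = false) /=; last by case: eqP => // ?; exfalso; lia.
  by rewrite !mulr0 !mulr1 subr0 add0r.
split=> //.
  rewrite qE {2}/spike !(polDr fr) (polNr fr) !(polZr fr) B0 B1 pol_eb // Ci mulr1.
  have -> : - (2 * cc i) - 2 * cc i + 2 * s * (cc i * (2 * s)) =
            4 * cc i * (s ^+ 2 - 1) by ring.
  by rewrite s2 subrr mulr0.
move=> j Hj; rewrite co_spike; last by lia.
rewrite (_ : (j == 0)%N = false) /=; last by case: eqP => // ?; exfalso; lia.
rewrite (_ : (j == 1)%N = false) /=; last by case: eqP => // ?; exfalso; lia.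
rewrite (_ : (j == i)%N = false) /=; last by case: eqP => // ?; exfalso; lia.
by rewrite !mulr0 subr0 addr0.
Qed.

Lemma flag_eb0 k : (k < n)%N -> flag fr k (eb 0).
Proof. by move=> kn; apply: flag_eb. Qed.
Lemma flag_eb1 k : (k < n)%N -> flag fr k (eb 1).
Proof. by move=> kn; apply: flag_eb. Qed.

Lemma nonvanishing_co k : (k.+1 < n)%N -> nonvanishing fr k.+1 (co k.+2).
Proof.
move=> kn; have [|q0 B1 _ C fl] := @spikeP k.+2 1 _ (expr1n _ _); first by lia.
exists (spike k.+2 1), (eb 1); split=> //; first by apply: flag_eb1; lia.
- by rewrite B1 oner_neq0.
by rewrite C mulr1 (two_neq0 fr).
Qed.

Lemma nonvanishing_ext k f g :
  (forall v, f v = g v) -> nonvanishing fr k f -> nonvanishing fr k g.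
Proof. by move=> fg [a [u [? ? ? ? Hf]]]; exists a, u; split; rewrite -?fg. Qed.

(** Induction on the last variable x of the flag. If some word without x has a nonzero coefficient,
    restrict to x = 0; otherwise x factors out, and irreducibility reduces the claim to the
    quotient, of lower degree. *)
Lemma lcomb_nonvanishing k t c : (k < n)%N ->
  (exists2 i, (i < size (words k t))%N & c i != 0) ->
  nonvanishing fr k (lcomb (words k t) c).
Proof.
have n1 := n_gt1 fr.
have cst k' d : (k' < n)%N -> (exists2 i, (i < 1)%N & d i != 0) ->
    nonvanishing fr k' (lcomb [:: [::]] d).
  move=> kn [[|//] _ d0]; exists (eb 0), (eb 1); split.
  - exact: flag_eb0.
  - exact: flag_eb1.
  - exact: q_eb0.
  - by rewrite pol_eb01 oner_neq0.
  by rewrite /lcomb /= big_nat1 /monom big_nil mulr1.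
elim: k t c => [|k IHk] t c kn.
  case: t => [|t]; first exact: cst.
  rewrite words0S.
  have [c0|c0] := eqVneq (c 0%N) 0; last first.
    move=> _; exists (eb 0), (eb 1); split; first exact: flag_eb0.
    - exact: flag_eb1.
    - exact: q_eb0.
    - by rewrite pol_eb01 oner_neq0.
    by rewrite lcomb2 !monom_nseq !co_eb // expr1n expr0n mulr1 mulr0 addr0.
  case=> [[|[|//]]] _; first by rewrite c0 eqxx.
  move=> c1; exists (eb 1), (eb 0); split; first exact: flag_eb1.
  - exact: flag_eb0.
  - exact: q_eb1.
  - by rewrite (polC fr) pol_eb01 oner_neq0.
  by rewrite lcomb2 !monom_nseq !co_eb // expr1n mulr1 c0 mul0r add0r.
elim: t c => [|t IHt] c; first exact: cst.
rewrite wordsS size_cat size_map => -[i Hi ci].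
have [/hasP[j]|/hasPn Hn] :=
    boolP (has (fun j => c j != 0) (iota 0 (size (words k t.+1)))).
  rewrite mem_iota add0n => /andP[_ Hj] cj.
  have [|a [u [fa fu qa Bau fa0]]] := IHk t.+1 c (ltnW kn); first by exists j.
  exists a, u; split=> //; try by [apply: flag_le (leqnSn k) _].
  rewrite lcomb_cat lcomb_cons fa ?mul0r ?addr0 //; lia.
have Hle : (size (words k t.+1) <= i)%N.
  by rewrite leqNgt; apply/negP => Hlt; have := Hn i; rewrite mem_iota Hlt ci => /(_ isT).
have /IHt nv : exists2 j, (j < size (words k.+1 t))%N & c (size (words k t.+1) + j)%N != 0.
  by exists (i - size (words k t.+1))%N; rewrite ?subnKC //; lia.
have := nonvanishingM (ltn0Sn k) kn (form_lin (co_lin fr k.+2)) (form_lcomb _ _ _)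
   (nonvanishing_co kn) nv.
apply: nonvanishing_ext => v; rewrite lcomb_cat lcomb_cons.
rewrite [X in _ = X + _](_ : _ = 0) ?add0r // /lcomb big_nat big1 // => j /andP[_ Hj].
have := Hn j; rewrite mem_iota Hj negbK => /(_ isT)/eqP->.
by rewrite mul0r.
Qed.

(** There are fewer conditions than coefficients, so the evaluation matrix has a nonzero kernel
    vector. *)
Lemma exists_lcomb_vanishing ws (zs : seq vec) : (size zs < size ws)%N ->
  exists c, (exists2 i, (i < size ws)%N & c i != 0) /\
    forall z, z \in zs -> lcomb ws c z = 0.
Proof.
move=> Hs.
pose M := \matrix_(i < size ws, j < size zs) monom (nth [::] ws i) (nth 0 zs j).
have K0 : kermx M != 0.
  rewrite kermx_eq0 /row_free neq_ltn (leq_ltn_trans (rank_leq_col M)) //.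
pose u := nz_row (kermx M).
have u0 : u != 0 by rewrite nz_row_eq0.
have uM : u *m M = 0 by apply/sub_kermxP; apply: nz_row_sub.
pose c i := if insub i is Some j then u 0 j else 0.
have cE (j : 'I_(size ws)) : c j = u 0 j by rewrite /c valK.
exists c; split.
  by have /rV0Pn[j uj] := u0; exists j => //; rewrite cE.
move=> z /(nthP 0)[j Hj <-]; have /rowP/(_ (Ordinal Hj)) := uM.
rewrite mxE [RHS]mxE => <-.
rewrite /lcomb big_mkord; apply: eq_bigr => i _.
by rewrite cE mxE.
Qed.

Lemma exists_form_vanishing k t (zs : seq vec) :
  (k < n)%N -> (size zs < size (words k t))%N ->
  exists f, [/\ pform t f, forall z, z \in zs -> f z = 0 & nonvanishing fr k f].
Proof.
move=> kn /exists_lcomb_vanishing[c [Hc Hz]].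
by exists (lcomb (words k t) c); split=> //; [apply: form_lcomb | apply: lcomb_nonvanishing].
Qed.

(** * Reduction of polynomials modulo the equation of the quadric *)

Local Notation Q := (quadric_poly A).
Local Notation K := (n.-1).

Definition mpco i : {mpoly F[n.+1]} := \sum_j co i (delta_mx 0 j) *: 'X_j.
Definition mpmonom (w : seq nat) := \prod_(i <- w) mpco i.

Lemma co_delta i v : co i v = \sum_j v 0 j * co i (delta_mx 0 j).
Proof.
have [w Hw] := co_lin fr i; rewrite Hw mxE; apply: eq_bigr => j _; rewrite Hw.
congr (_ * _); rewrite mxE (bigD1 j) //= mxE !eqxx mul1r big1 ?addr0 //.
by move=> l lj; rewrite mxE (negPf lj) andbF mul0r.
Qed.

Lemma evalp_mpco i v : evalp (mpco i) v = co i v.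
Proof.
rewrite /evalp raddf_sum /= co_delta; apply: eq_bigr => j _.
by rewrite mevalZ mevalXU mulrC.
Qed.

Lemma evalp_mpmonom w v : evalp (mpmonom w) v = monom w v.
Proof.
rewrite /mpmonom /monom; elim: w => [|i w IH]; first by rewrite /evalp !big_nil meval1.
by rewrite /evalp !big_cons mevalM -/(evalp _ _) evalp_mpco -IH.
Qed.

Lemma mpX_mpco (j : 'I_n.+1) : 'X_j = \sum_(i < n.+1) eb i 0 j *: mpco i.
Proof.
under eq_bigr do rewrite scaler_sumr.
rewrite exchange_big /= (bigD1 j) //= [X in _ + X]big1 ?addr0.
  under eq_bigr do rewrite scalerA.
  rewrite -scaler_suml (_ : \sum_ _ _ = 1) ?scale1r //.
  have /rowP/(_ j) := vec_eb fr (delta_mx 0 j); rewrite summxE [LHS]mxE !eqxx /= => H.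
  by rewrite [RHS]H; apply: eq_bigr => i _; rewrite mxE mulrC.
move=> l lj; under eq_bigr do rewrite scalerA.
rewrite -scaler_suml (_ : \sum_ _ _ = 0) ?scale0r //.
have /rowP/(_ j) := vec_eb fr (delta_mx 0 l); rewrite summxE [LHS]mxE eq_sym (negPf lj) andbF => H.
by rewrite [RHS]H; apply: eq_bigr => i _; rewrite mxE mulrC.
Qed.

Lemma quadric_polyE : Q = 2 * (mpco 0 * mpco 1) +
  \sum_(2 <= i < n.+1) cc i *: (mpco i * mpco i).
Proof.
pose bp i : {mpoly F[n.+1]} := \sum_l B (delta_mx 0 l) (eb i) *: 'X_l.
have -> : Q = \sum_(i < n.+1) bp i * mpco i.
  rewrite /quadric_poly.
  under [RHS]eq_bigr => i _.
    rewrite mulr_suml; under eq_bigr => l _ do rewrite mulr_sumr.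
    over.
  rewrite [RHS]exchange_big /=; apply: eq_bigr => l _.
  rewrite [RHS]exchange_big /=; apply: eq_bigr => m _.
  under [RHS]eq_bigr => i _ do rewrite -scalerAl -scalerAr scalerA.
  rewrite -scaler_suml; congr (_ *: _).
  have -> : A l m = B (delta_mx 0 l) (delta_mx 0 m).
    by rewrite /qpolar -rowE mxE (bigD1 m) //= !mxE !eqxx mulr1 big1 ?addr0 // => i im;
       rewrite !mxE (negPf im) andbF mulr0.
  rewrite {1}(vec_eb fr (delta_mx 0 m)).
  have Bsum (f : 'I_n.+1 -> vec) x : B x (\sum_i f i) = \sum_i B x (f i).
    elim/big_ind2: _ => // [|a1 b1 a2 b2 <- <-]; last by rewrite (polDr fr).
    by rewrite -(scale0r (0 : vec)) (polZr fr) mul0r.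
  by rewrite Bsum; apply: eq_bigr => i _; rewrite (polZr fr) mulrC.
rewrite -(big_mkord xpredT (fun i => bp i * mpco i)).
have n1 := n_gt1 fr.
rewrite big_ltn // big_ltn //.
have -> : bp 0%N = mpco 1 by apply: eq_bigr => l _; rewrite pol_eb0.
have -> : bp 1%N = mpco 0 by apply: eq_bigr => l _; rewrite pol_eb1.
rewrite addrA (mulrC (mpco 1)) -mulr2n mulr_natl; congr (_ + _).
rewrite !big_nat; apply: eq_bigr => i Hi.
rewrite scalerAl; congr (_ * _); rewrite /bp scaler_sumr; apply: eq_bigr => l _.
by rewrite pol_eb // scalerA.
Qed.

Definition spanned t (p : {mpoly F[n.+1]}) := exists (c : nat -> F) g,
  p = \sum_(0 <= i < size (words K t)) c i *: mpmonom (nth [::] (words K t) i) + Q * g.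

Lemma spannedD t p r : spanned t p -> spanned t r -> spanned t (p + r).
Proof.
move=> [c [g ->]] [d [h ->]]; exists (fun i => c i + d i), (g + h).
under [in RHS]eq_bigr do rewrite scalerDl.
by rewrite big_split /= mulrDr addrACA.
Qed.

Lemma spannedZ t a p : spanned t p -> spanned t (a *: p).
Proof.
move=> [c [g ->]]; exists (fun i => a * c i), (a *: g).
under [in RHS]eq_bigr do rewrite -scalerA.
by rewrite -scaler_sumr -scalerAr scalerDr.
Qed.

Lemma spannedQ t g : spanned t (Q * g).
Proof.
by exists (fun=> 0), g; rewrite big1 ?add0r // => i _; rewrite scale0r.
Qed.

Lemma spanned_sum t (I : eqType) (r : seq I) (f : I -> {mpoly F[n.+1]}) :
  (forall i, i \in r -> spanned t (f i)) -> spanned t (\sum_(i <- r) f i).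
Proof.
move=> Hf; rewrite big_seq; elim/big_ind: _.
- by rewrite -(mulr0 Q); apply: spannedQ.
- by move=> p p0; apply: spannedD.
- exact: Hf.
Qed.

Lemma mpmonom_perm w w' : perm_eq w w' -> mpmonom w = mpmonom w'.
Proof. by move=> pw; apply: perm_big. Qed.

Lemma spanned_words t w : w \in words K t -> spanned t (mpmonom w).
Proof.
move=> /(nthP [::])[i Hi <-]; exists (fun j => (j == i)%:R), 0.
rewrite mulr0 addr0 (bigD1_seq i) ?mem_index_iota ?iota_uniq //=.
rewrite eqxx scale1r big1 ?addr0 // => j /negPf->; exact: scale0r.
Qed.

(** Modulo [Q] the product x_0 x_1 is a combination of the squares x_i^2 with [i >= 2]. Each
    replacement lowers the number of factors x_0, which is the induction measure. *)
Lemma spanned_mpmonom w :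
  all (fun i => i < n.+1)%N w -> spanned (size w) (mpmonom w).
Proof.
have [m Hm] := ubnP (count_mem 0%N w); elim: m w Hm => // m IH w Hm aw.
have [/andP[w0 w1]|nw] := boolP ((0%N \in w) && (1%N \in w)); last first.
  have [|w' Hw' pw] := @words_perm K _ w erefl _ nw.
    apply/allP => i /(allP aw); have := frame_dim fr; lia.
  by rewrite (mpmonom_perm pw); apply: spanned_words.
have p0 := perm_to_rem w0.
have w1' : 1%N \in rem 0%N w by have := perm_mem p0 1%N; rewrite w1 inE /= => <-.
have p1 := perm_to_rem w1'.
set u := rem 1%N (rem 0%N w) in p1.
have pw : perm_eq w [:: 0%N, 1%N & u] by apply: perm_trans p0 _; rewrite perm_cons.
rewrite (mpmonom_perm pw) (perm_size pw) /= /mpmonom !big_cons -/(mpmonom u).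
have two2 : (2 : F) != 0 := two_neq0 fr.
have -> : mpco 0 * (mpco 1 * mpmonom u) = 2^-1 *: (Q * mpmonom u +
   (- 1) *: \sum_(i <- index_iota 2 n.+1) cc i *: mpmonom [:: i, i & u]).
  rewrite quadric_polyE mulrDl [(\sum_(2 <= i < n.+1) _) * _]mulr_suml scaleN1r.
  rewrite [X in _ - X](eq_bigr (fun i => cc i *: (mpco i * mpco i) * mpmonom u)).
    rewrite addrK mulr_natl -scaler_nat -scalerAl scalerA mulVf // scale1r mulrA.
    by [].
  by move=> i _; rewrite /mpmonom !big_cons mulrA scalerAl.
apply: spannedZ; apply: spannedD; first exact: spannedQ.
apply: spannedZ; apply: spanned_sum => i; rewrite mem_index_iota => /andP[i2 iN].
apply: spannedZ; rewrite -[(size u).+2]/(size [:: i, i & u]); apply: IH.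
  have := Hm; have /permP -> := pw; rewrite /= ltnS.
  rewrite (_ : (i == 0)%N = false) ?add0n; last by case: eqP => // ?; exfalso; lia.
  by rewrite add1n.
move: aw; rewrite (perm_all _ pw) /= => /andP[_ au].
by rewrite iN au.
Qed.

(** The original variables are traded one at a time for frame coordinates, which [w] accumulates. *)
Lemma spanned_mpolyX (m : 'X_{1..n.+1}) w : all (fun i => i < n.+1)%N w ->
  spanned (size w + mdeg m) (mpmonom w * 'X_[m]).
Proof.
move Ed : (mdeg m) => d; elim: d m w Ed => [|d IH] m w Ed aw.
  move/eqP: Ed; rewrite mdeg_eq0 => /eqP->; rewrite mpolyX0 mulr1 addn0.
  exact: spanned_mpmonom.
have [j mj] : exists j, m j != 0%N.
  apply/existsP; apply: contraPT Ed => /existsPn H; rewrite mdegE big1 // => j _.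
  by apply/eqP; have := H j; rewrite negbK.
have Em : m = (U_(j) + (m - U_(j)))%MM by rewrite addmC submK // lep1mP.
have Ed' : mdeg (m - U_(j))%MM = d.
  by move: Ed; rewrite {1}Em mdegD mdeg1 add1n => -[].
rewrite Em mpolyXD mulrA mpX_mpco mulr_sumr mulr_suml.
apply: spanned_sum => i _; rewrite -scalerAr -scalerAl; apply: spannedZ.
have -> : mpmonom w * mpco i = mpmonom (val i :: w) by rewrite /mpmonom big_cons mulrC.
by rewrite addnS -addSn; apply: (IH _ (val i :: w)) => //=; rewrite ltn_ord.
Qed.

Lemma homog_spanned t p : p \is t.-homog -> spanned t p.
Proof.
move=> /dhomogP Hp; rewrite (mpolyE p); apply: spanned_sum => m Hm.
apply: spannedZ; have := @spanned_mpolyX m [::] isT.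
by rewrite /mpmonom big_nil mul1r add0n (Hp m Hm).
Qed.

Lemma evalp_quadric v : evalp Q v = q v.
Proof.
rewrite /evalp /quadric_poly raddf_sum /qform mxE.
under [RHS]eq_bigr => j _ do rewrite mxE mulr_suml.
rewrite exchange_big /=; apply: eq_bigr => i _; rewrite raddf_sum /=.
by apply: eq_bigr => j _; rewrite mevalZ mevalM !mevalXU mxE; ring.
Qed.

Lemma form_lcombE t f : pform t f ->
  exists c, forall v, q v = 0 -> f v = lcomb (words K t) c v.
Proof.
move=> /form_mpoly[p Hp pE]; have [c [g Hc]] := homog_spanned Hp.
exists c => v qv; rewrite -pE Hc /evalp mevalD mevalM -![meval _ _]/(evalp _ v) evalp_quadric qv.
rewrite mul0r /evalp addr0 raddf_sum /=; apply: eq_bigr => i _.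
by rewrite mevalZ -/(evalp _ _) evalp_mpmonom.
Qed.

End Words.

(** * Chains of lines and how to join them *)

Section Chains.
Variables (F : closedFieldType) (n : nat) (A : 'M[F]_(n.+1)) (fr : frame A).
Local Notation vec := 'rV[F]_(n.+1).
Local Notation B := (qpolar A).
Local Notation q := (qform A).
Local Notation co := (co fr).
Local Notation eb := (eb fr).
Local Notation cc := (cc fr).
Local Notation flag := (flag fr).

(** A line is recorded by its two points on the quadric; that they are not orthogonal makes them
    distinct and the intersection transversal. *)
Definition okpair k (p : vec * vec) :=
  [/\ flag k p.1, flag k p.2, q p.1 = 0, q p.2 = 0 & B p.1 p.2 != 0].

Definition on_pair (o : vec) (p : vec * vec) := exists x y, o = x *: p.1 + y *: p.2.

(** The common point is required to be off the quadric, so a node is never a point of T on W and can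
    serve as the axis of a reflection. *)
Definition link p p' := exists o, [/\ on_pair o p, on_pair o p' & q o != 0].

(* Lines of a chain may coincide, and nonconsecutive ones may meet: only the generic
   chain is a bamboo. *)
Fixpoint chain k (C : seq (vec * vec)) :=
  if C is p :: C' then
    [/\ okpair k p, if C' is p' :: _ then link p p' else True & chain k C']
  else True.

Fixpoint pts (C : seq (vec * vec)) : seq vec :=
  if C is p :: C' then [:: p.1, p.2 & pts C'] else [::].

(** Values are prescribed on points rather than on positions of the list, so repetitions are
    excluded separately. *)
Definition independent t (zs : seq vec) := uniq zs /\
  forall v : vec -> F, exists2 f, pform t f & forall z, z \in zs -> f z = v z.

Lemma pts_cat C D : pts (C ++ D) = pts C ++ pts D.
Proof. by elim: C => //= p C ->. Qed.

Lemma size_pts C : size (pts C) = (size C).*2.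
Proof. by elim: C => //= p C ->. Qed.

Lemma pts_pairs C z : z \in pts C -> exists2 p, p \in C & (z = p.1) \/ (z = p.2).
Proof.
elim: C => //= p C IH; rewrite !inE => /or3P[/eqP->|/eqP->|/IH[p' Hp' Hz]].
- by exists p; rewrite ?inE ?eqxx //; left.
- by exists p; rewrite ?inE ?eqxx //; right.
by exists p'; rewrite // inE Hp' orbT.
Qed.

Lemma chain_ok k C p : chain k C -> p \in C -> okpair k p.
Proof.
elim: C => //= p' C IH [Hp _ HC]; rewrite inE => /orP[/eqP->//|]; exact: IH.
Qed.

Lemma chain_pts k C z : chain k C -> z \in pts C ->
  [/\ flag k z, q z = 0 & exists2 u, flag k u & B z u != 0].
Proof.
move=> HC /pts_pairs[p /(chain_ok HC)[f1 f2 q1 q2 B12] [->|->]]; split=> //.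
- by exists p.2.
- by exists p.1; rewrite // (polC fr).
Qed.

Lemma chain_le k l C : (k <= l)%N -> chain k C -> chain l C.
Proof.
move=> kl; elim: C => //= p C IH [[? ? ? ? ?] Hl /IH HC]; split=> //; split=> //.
- exact: flag_le kl _.
- exact: flag_le kl _.
Qed.

Lemma chain_take k m C : chain k C -> chain k (take m C).
Proof.
elim: C m => [|p C IH] [|m] //= [Hp Hl HC]; split=> //; last exact: IH.
by case: C {IH HC} Hl m => [|p' C] Hl [|m].
Qed.

Lemma pts_take m C : {subset pts (take m C) <= pts C}.
Proof.
elim: C m => [|p C IH] [|m] //= z; rewrite !inE.
by case/or3P => [->|->|/IH->]; rewrite ?orbT.
Qed.

Lemma uniq_pts_take m C : uniq (pts C) -> uniq (pts (take m C)).
Proof.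
by rewrite -{1}(cat_take_drop m C) pts_cat cat_uniq => /and3P[].
Qed.

Lemma chain_cat k p C p' C' : chain k (p :: C) -> chain k (p' :: C') ->
  link (last p C) p' -> chain k ((p :: C) ++ p' :: C').
Proof.
elim: C p => [|p1 C IH] p; first by move=> [Hp _ _] HC' Hl; split.
move=> [Hp Hl HC] HC' Hlk; have := IH p1 HC HC' Hlk.
by split.
Qed.

Lemma independent_sub t zs us : independent t zs -> uniq us -> {subset us <= zs} ->
  independent t us.
Proof.
move=> [_ H] uu sub; split=> // v; have [f Hf Hz] := H v.
by exists f => // z /sub; apply: Hz.
Qed.

Lemma independent_perm t zs us : perm_eq zs us -> independent t zs -> independent t us.
Proof.
move=> p H; apply: (independent_sub H).
  by rewrite -(perm_uniq p); case: H.
by move=> z; rewrite (perm_mem p).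
Qed.

Lemma independent_cons t zs f z : independent t zs -> pform t f ->
  (forall y, y \in zs -> f y = 0) -> f z != 0 -> independent t (z :: zs).
Proof.
move=> [uz H] Hf Hz fz; split.
  by rewrite /= uz andbT; apply/negP => /Hz fz0; rewrite fz0 eqxx in fz.
move=> v; have [g Hg gz] := H v.
exists (fun x => g x + (v z - g z) / f z * f x).
  by apply: (form_add Hg (form_scale ((v z - g z) / f z) Hf)).
move=> y; rewrite inE => /orP[/eqP->|yz]; first by rewrite divfK // addrC subrK.
by rewrite (gz _ yz) (Hz _ yz) mulr0 addr0.
Qed.

Lemma independent_union t j ns fs : independent t ns -> independent t.+1 fs ->
  (forall z, z \in ns -> co j z != 0) -> (forall z, z \in fs -> co j z = 0) ->
  independent t.+1 (ns ++ fs).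
Proof.
move=> [un Hn] [uf Hf] cn cf; split.
  rewrite cat_uniq un uf andbT; apply/hasPn => z zf; apply/negP => zn.
  by have := cn z zn; rewrite (cf z zf) eqxx.
move=> v; have [f f1 f2] := Hf v.
have [g g1 g2] := Hn (fun z => (v z - f z) / co j z).
exists (fun z => f z + co j z * g z).
  have Hg : pform t.+1 (fun z => co j z * g z) by apply: (form_mul (co_lin fr j) g1).
  exact: (form_add f1 Hg).
move=> z; rewrite mem_cat => /orP[zn|zf]; last by rewrite cf // mul0r addr0 f2.
by rewrite g2 // mulrC divfK ?cn // addrC subrK.
Qed.

Lemma refl_inj u : q u != 0 -> injective (refl A u).
Proof.
move=> qu x y H; have := congr1 (refl A u) H; rewrite !reflK.
by move/scalerI; apply; rewrite expf_neq0.
Qed.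

Lemma independent_refl t u zs : q u != 0 -> independent t zs ->
  independent t (map (refl A u) zs).
Proof.
move=> qu [uz H]; split; first by rewrite map_inj_uniq //; apply: refl_inj.
move=> v; have [f f1 f2] := H (fun z => v (refl A u z)).
exists (fun z => (q u ^+ 2) ^- t * f (refl A u z)).
  by apply: form_scale; apply: form_refl.
move=> _ /mapP[z zz ->]; rewrite reflK (form_homog f1) mulrA mulVf ?mul1r ?f2 //.
by rewrite !expf_neq0.
Qed.

Definition refl2 u (p : vec * vec) := (refl A u p.1, refl A u p.2).

Lemma pts_refl u C : pts (map (refl2 u) C) = map (refl A u) (pts C).
Proof. by elim: C => //= p C ->. Qed.

Lemma reflD u x y : refl A u (x + y) = refl A u x + refl A u y.
Proof. by have [M HM] := refl_mulmx A u; rewrite !HM mulmxDl. Qed.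

Lemma reflZ u c x : refl A u (c *: x) = c *: refl A u x.
Proof. by have [M HM] := refl_mulmx A u; rewrite !HM scalemxAl. Qed.

Lemma on_pair_refl u o p : on_pair o p -> on_pair (refl A u o) (refl2 u p).
Proof. by move=> [x [y ->]]; exists x, y; rewrite reflD !reflZ. Qed.

Lemma on_pairZ c o p : on_pair o p -> on_pair (c *: o) p.
Proof.
by move=> [x [y ->]]; exists (c * x), (c * y); rewrite scalerDr !scalerA.
Qed.

Lemma chain_refl k u C : flag k u -> q u != 0 -> chain k C ->
  chain k (map (refl2 u) C).
Proof.
move=> fu qu; elim: C => //= p C IH [[f1 f2 q1 q2 B12] Hl /IH HC]; split=> //.
  split=> /=; try exact: flag_refl.
  - by rewrite (qform_refl fr) q1 mulr0.
  - by rewrite (qform_refl fr) q2 mulr0.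
  by rewrite (pol_refl fr) mulf_neq0 ?expf_neq0.
case: C Hl {IH HC} => //= p' C [o [H1 H2 qo]]; exists (refl A u o).
split; try exact: on_pair_refl.
by rewrite (qform_refl fr) mulf_neq0 ?expf_neq0.
Qed.

Lemma qform_lc a b x y : q a = 0 -> q b = 0 -> q (x *: a + y *: b) = 2 * x * y * B a b.
Proof.
rewrite !qE => qa qb; rewrite !(polE fr) qa qb (polC fr b a); ring.
Qed.

(** Norm 1 is what allows one node to be carried to a multiple of another by a single reflection. *)
Lemma unit_node k p : okpair k p -> exists o, [/\ on_pair o p, q o = 1 & flag k o].
Proof.
move=> [f1 f2 q1 q2 B12]; exists (1 *: p.1 + (2 * B p.1 p.2)^-1 *: p.2); split.
- by exists 1, (2 * B p.1 p.2)^-1.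
- by rewrite qform_lc // mulr1 mulrAC mulfV // mulf_neq0 // (two_neq0 fr).
by apply: flagD; apply: flagZ.
Qed.

Lemma pol_subZ z x c y : B z (x - c *: y) = B z x - c * B z y.
Proof. by rewrite !(polE fr). Qed.

(** Projection to the orthogonal of [o], multiplied by [q o] to avoid a division. The reflection
    with such an axis fixes [o] up to a scalar. *)
Definition ortho k (o w : vec) := q o *: trunc fr k w - B (trunc fr k w) o *: o.

Lemma pol_ortho k o w : B (ortho k o w) o = 0.
Proof. by rewrite /ortho !(polE fr) qE; ring. Qed.

Lemma polyvec_ortho k o : polyvec (ortho k o).
Proof.
apply: polyvec_linear => s u v; rewrite /ortho trunc_linear !(polE fr).
by apply/rowP => i; rewrite !mxE; ring.
Qed.

Lemma flag_ortho k l o w : flag k o -> flag k w -> (k <= l)%N -> flag k (ortho l o w).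
Proof.
move=> fo fw kl; rewrite /ortho trunc_id; last exact: flag_le kl _.
by rewrite -scaleNr; apply: flagD; apply: flagZ.
Qed.

Lemma qform_ortho k o w : flag k w ->
  q (ortho k o w) = q o * (q o * q w - B w o ^+ 2).
Proof.
move=> fw; rewrite /ortho trunc_id // !qE !(polE fr) (polC fr o w); ring.
Qed.

(** An isotropic [w] not orthogonal to [o] works, because its projection has norm
    [- q o * B w o ^+ 2]. If neither [eb 0] nor [eb 1] is of this kind, their sum is orthogonal to
    [o] and has norm 2. *)
Lemma ortho_aniso k l o : (k < n)%N -> (k <= l)%N -> q o != 0 ->
  exists2 w, flag k w & q (ortho l o w) != 0.
Proof.
move=> kn kl qo.
have f0 := flag_eb0 fr kn; have f1 := flag_eb1 fr kn.
have H w : flag k w -> q w = 0 -> B w o != 0 ->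
    exists2 w, flag k w & q (ortho l o w) != 0.
  move=> fw qw Bw; exists w; rewrite // qform_ortho; last exact: flag_le kl _.
  by rewrite qw mulr0 sub0r mulf_neq0 // oppr_eq0 expf_neq0.
have [B0|] := eqVneq (B (eb 0) o) 0; last by apply: H => //; apply: q_eb0.
have [B1|] := eqVneq (B (eb 1) o) 0; last by apply: H => //; apply: q_eb1.
exists (eb 0 + eb 1); first exact: flagD.
rewrite qform_ortho; last by apply: flag_le kl _; apply: flagD.
rewrite (polDl _ (eb 0)) B0 B1 addr0 expr0n subr0 -[eb 0]scale1r -[eb 1]scale1r.
rewrite qform_lc ?q_eb0 ?q_eb1 // pol_eb01 !mulr1 !mulf_neq0 //; exact: (two_neq0 fr).
Qed.

(** The axis is a generic vector orthogonal to [o]. By genericity it is enough to find, for each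
    point separately, one axis that moves it off H. *)
Lemma move_off k o (zs : seq vec) : (k.+1 < n)%N -> flag k o -> q o != 0 ->
  (forall z, z \in zs ->
     [/\ flag k.+1 z, q z = 0 & exists2 u, flag k.+1 u & B z u != 0]) ->
  exists u, [/\ flag k.+1 u, q u != 0, B u o = 0 &
    forall z, z \in zs -> co k.+2 (refl A u z) != 0].
Proof.
move=> kn fo qo Hzs.
have jn : (k.+1 < k.+2 < n.+1)%N by lia.
pose f (x : option vec) w :=
  if x is Some z then co k.+2 (refl A (ortho k.+1 o w) z) else q (ortho k.+1 o w).
have pf x : polyfun (f x).
  have po := @polyvec_ortho k.+1 o.
  case: x => [z|] /=; last exact: (polyfun_pol A po po).
  apply: (form_polyfun (form_lin (co_lin fr k.+2))).
  by apply: polyvec_refl => //; apply: polyvec_cst.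
have coE u z : co k.+2 (refl A u z) = q u * co k.+2 z - 2 * B z u * co k.+2 u.
  rewrite /refl -scaleNr (linD (co_lin fr _)) !(linZ (co_lin fr _)); ring.
have [w0 fw0 qw0] := @ortho_aniso k k.+1 o (ltnW kn) (leqnSn k) qo.
have [||w Hw] := @polyfun_common_seq _ _ _ (None :: map Some zs) f.
- by move=> x _; apply: pf.
- move=> [z|] /=; last by move=> _; exists w0.
  rewrite inE /= => /mapP[y /Hzs[fz qz [u fu Bu]] [->]] {z}.
  move: y fz qz Bu => z fz qz Bu.
  have [zj|zj] := eqVneq (co k.+2 z) 0; last first.
    exists w0; rewrite coE (flag_ortho fo fw0 (leqnSn k)) // mulr0 subr0 mulf_neq0 //.
  have fzk : flag k z by apply: flag_last => //; lia.
  have Bzj : B z (eb k.+2) = 0 by rewrite pol_eb ?zj ?mulr0 //; lia.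
  have Boj : B (eb k.+2) o = 0.
    by rewrite (polC fr) pol_eb ?(fo _ jn) ?mulr0 //; lia.
  (* The expression is the pairing of [z] with the projection of [x]. Take [z] itself if it is not
     orthogonal to [o], and otherwise [u] with its last coordinate removed. *)
  have [x fx Hx] : exists2 x, flag k x & q o * B z x - B x o * B z o != 0.
    have [Bzo|Bzo] := eqVneq (B z o) 0; last first.
      by exists z; rewrite // -qE qz mulr0 sub0r oppr_eq0 mulf_neq0.
    exists (u - co k.+2 u *: eb k.+2).
      apply: flag_last; first by lia.
        rewrite -scaleNr; apply: flagD => //; apply: flagZ; apply: flag_eb; lia.
      rewrite -scaleNr (linD (co_lin fr _)) (linZ (co_lin fr _)) co_eb ?eqxx; try lia.
      by rewrite mulr1 subrr.
    by rewrite Bzo mulr0 subr0 !(polE fr) Bzj mulr0 subr0 mulf_neq0.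
  (* As [z] is in H, its image leaves H when the axis is off H and not orthogonal to [z]; adding
     [eb k.+2] gives the first and preserves the second. *)
  exists (x + eb k.+2).
  have fl : flag k.+1 (x + eb k.+2).
    apply: flagD; first exact: flag_le (leqnSn k) _.
    by apply: flag_eb; lia.
  have oE : ortho k.+1 o (x + eb k.+2) = q o *: (x + eb k.+2) - B x o *: o.
    by rewrite /ortho trunc_id // polDl Boj addr0.
  rewrite coE zj mulr0 sub0r oppr_eq0 oE.
  have -> : B z (q o *: (x + eb k.+2) - B x o *: o) = q o * B z x - B x o * B z o.
    by rewrite !(polE fr) Bzj addr0.
  have -> : co k.+2 (q o *: (x + eb k.+2) - B x o *: o) = q o.
    rewrite -scaleNr !(linD (co_lin fr _), linZ (co_lin fr _)) (fx _ jn) (fo _ jn).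
    by rewrite co_eb ?eqxx; try lia; rewrite mulr0 addr0 add0r mulr1.
  by rewrite !mulf_neq0 // (two_neq0 fr).
exists (ortho k.+1 o w); split.
- rewrite /ortho -scaleNr; apply: flagD; apply: flagZ; first exact: flag_trunc.
  exact: flag_le (leqnSn k) _.
- by apply: (Hw None); rewrite inE.
- exact: pol_ortho.
by move=> z zz; apply: (Hw (Some z)); rewrite inE map_f ?orbT.
Qed.

(** One reflection carries a node of the first chain to a node of the second; a further one, fixing
    that node, moves all points of the first chain off H. Neither affects independence. *)
Lemma join_chains k p C p' C' : (k.+1 < n)%N ->
  chain k.+1 (p :: C) -> chain k (p' :: C') ->
  exists D, [/\ size D = (size C).+1, chain k.+1 (D ++ p' :: C'),
    forall z, z \in pts D -> co k.+2 z != 0 &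
    forall t, independent t (pts (p :: C)) -> independent t (pts D)].
Proof.
move=> kn HC HC'.
have Hlast : okpair k.+1 (last p C) by apply: chain_ok HC _; apply: mem_last.
have [o [op qo fo]] := unit_node Hlast.
have [o' [op' qo' fo']] := unit_node (chain_ok HC' (mem_head _ _)).
have fo'1 : flag k.+1 o' by apply: flag_le (leqnSn k) _.
have [w [fw qw [c c0 Hc]]] : exists w, [/\ flag k.+1 w, q w != 0 &
    exists2 c, c != 0 & refl A w o = c *: o'].
  (* The reflections in [o - o'] and in [o + o'] both send [o] to a multiple of [o']. The two norms
     add up to 4, so one of the axes is anisotropic. *)
  have E1 : q (o - o') = 2 - 2 * B o o'.
    by rewrite qE !(polE fr) -!qE qo qo' (polC fr o' o); ring.
  have E2 : q (o + o') = 2 + 2 * B o o'.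
    by rewrite qE !(polE fr) -!qE qo qo' (polC fr o' o); ring.
  have [q0|q0] := eqVneq (q (o - o')) 0; last first.
    exists (o - o'); split=> //; first by rewrite -scaleN1r; apply: flagD => //; apply: flagZ.
    exists (q (o - o')) => //; rewrite /refl !(polE fr) -qE qo E1.
    by apply/rowP => i; rewrite !mxE; ring.
  have q4 : q (o + o') != 0.
    have -> : q (o + o') = 2 * 2 - q (o - o') by rewrite E1 E2; ring.
    by rewrite q0 subr0 mulf_neq0 // (two_neq0 fr).
  exists (o + o'); split=> //; first exact: flagD.
  exists (- q (o + o')); first by rewrite oppr_eq0.
  rewrite /refl !(polE fr) -qE qo E2.
  by apply/rowP => i; rewrite !mxE; ring.
have HC1 := chain_refl fw qw HC.
have [||u [fu qu Buo Hoff]] := @move_off k o' (pts (map (refl2 w) (p :: C))) kn fo'.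
- by rewrite qo' oner_neq0.
- by move=> z; apply: chain_pts HC1.
exists (map (refl2 u) (map (refl2 w) (p :: C))); split.
- by rewrite !size_map.
- apply: (@chain_cat k.+1 (refl2 u (refl2 w p)) (map (refl2 u) (map (refl2 w) C))).
  + exact: (chain_refl fu qu HC1).
  + exact: chain_le (leqnSn k) HC'.
  rewrite !last_map; exists (refl A u (refl A w o)); split.
  + by do 2 apply: on_pair_refl.
  + rewrite Hc reflZ; apply: on_pairZ; rewrite /refl (polC fr) Buo mulr0 scale0r subr0.
    exact: on_pairZ.
  by rewrite !(qform_refl fr) qo mulr1 mulf_neq0 // expf_neq0.
- by move=> z; rewrite pts_refl => /mapP[y yz ->]; apply: Hoff.
by move=> t Ht; rewrite !pts_refl; do 2 apply: independent_refl => //.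
Qed.

Lemma on_pair_axis o w : B w o != 0 -> on_pair o (w, refl A o w).
Proof.
move=> Bwo; exists ((2 * B w o)^-1 * q o), (- (2 * B w o)^-1).
have B2 : 2 * B w o != 0 by rewrite mulf_neq0 // (two_neq0 fr).
rewrite /refl /= scalerBr !scalerA mulNr (mulNr _ (2 * _)) mulVf // addrA.
by rewrite -scalerDl subrr scale0r add0r scaleN1r opprK.
Qed.

Lemma okpair_refl k o w : flag k w -> flag k o -> q w = 0 -> B w o != 0 ->
  okpair k (w, refl A o w).
Proof.
move=> fw fo qw Bwo; split=> //=; first exact: flag_refl.
  by rewrite (qform_refl fr) qw mulr0.
have -> : B w (refl A o w) = - (2 * B w o ^+ 2).
  by rewrite /refl !(polE fr) -(qE A w) qw; ring.
by rewrite oppr_eq0 mulf_neq0 ?expf_neq0 // (two_neq0 fr).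
Qed.

Lemma quadratic_root (c0 c1 c2 : F) : (c1 != 0) || (c2 != 0) ->
  exists x, c0 + c1 * x + c2 * x ^+ 2 = 0.
Proof.
move=> Hc; pose P := c0%:P + c1 *: 'X + c2 *: 'X^2.
have /closed_rootP[x /rootP Hx] : size P != 1%N.
  apply: contraTneq Hc => sP; rewrite negb_or !negbK.
  have cP i : (0 < i)%N -> P`_i = 0 by move=> Hi; rewrite nth_default // sP.
  have := cP 1%N isT; have := cP 2 isT.
  rewrite /P !coefE /= !mulr0 !mulr1 !add0r !addr0 => -> ->.
  by rewrite eqxx.
by exists x; rewrite -[RHS]Hx /P !hornerE.
Qed.

(** The spikes for [s = 1] and [s = -1] differ by a multiple of [eb k.+2], so [l] cannot vanish at
    both. *)
Lemma nonvanishing_lin k l : (k.+1 < n)%N -> lin l -> l (eb k.+2) != 0 ->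
  nonvanishing fr k.+1 l.
Proof.
move=> kn Hl H; have jn : (2 <= k.+2 < n.+1)%N by lia.
have nv s : s ^+ 2 = 1 -> l (spike fr k.+2 s) != 0 -> nonvanishing fr k.+1 l.
  move=> s2 Hs; have [q0 B1 _ _ fl] := spikeP fr jn s2.
  exists (spike fr k.+2 s), (eb 1); split=> //; first exact: flag_eb1.
  by rewrite B1 oner_neq0.
have [l1|] := eqVneq (l (spike fr k.+2 1)) 0; last by apply: nv; rewrite expr1n.
apply: (nv (- 1)); first by rewrite sqrrN expr1n.
have -> : spike fr k.+2 (-1) = spike fr k.+2 1 - (2 * 2) *: eb k.+2.
  by apply/rowP => i; rewrite !mxE; ring.
rewrite -scaleNr (linD Hl) (linZ Hl) l1 add0r mulf_neq0 // oppr_eq0 mulf_neq0 //;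
  exact: (two_neq0 fr).
Qed.

(* The new line joins [o] on [ab] to a point [u] of the quadric in the hyperplane
   [x_{k+2} = 0]; it meets the quadric again in [v], off this hyperplane. Only [f]
   is tested at [u] and only [g] at [v], so the two conditions are independent. *)
Lemma near_far_step k s t f g a b : (0 < k)%N -> (k.+1 < n)%N ->
  okpair k.+1 (a, b) -> co k.+2 b != 0 ->
  pform s f -> nonvanishing fr k f -> pform t g -> nonvanishing fr k.+1 g ->
  exists u v, [/\ okpair k.+1 (u, v), flag k u, co k.+2 v != 0,
    link (u, v) (a, b) & f u != 0 /\ g v != 0].
Proof.
move=> k0 kn [/= fa fb qa qb Bab] bj Hf nf Hg ng.
have two := two_neq0 fr; have k1 : (k < n)%N := ltnW kn.
have Bba : B b a != 0 by rewrite (polC fr).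
have jn : (k.+2 < n.+1)%N by [].
have jn2 : (2 <= k.+2 < n.+1)%N by [].
have jk : (k.+1 < k.+2 < n.+1)%N by rewrite ltnSn.
(* Up to sign and a nonzero factor this is the leading coefficient of the equation for [x] solved
   below: the quadratic one if [a] is off H, the linear one if [a] is in H. *)
pose psi z := if co k.+2 a == 0 then B a b * co k.+2 z - co k.+2 b * B z a else B z a.
have lpsi : lin psi.
  rewrite /psi; case: eqP => _; last exact: pol_lin.
  have := lin_add (lin_scale (B a b) (co_lin fr k.+2)) (lin_scale (- co k.+2 b) (pol_lin A a)).
  by case=> w Hw; exists w => v; rewrite -Hw mulNr.
have npsi : nonvanishing fr k.+1 psi.
  have [aj|aj] := eqVneq (co k.+2 a) 0; last first.
    by exists b, a; split=> //; rewrite /psi (negPf aj).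
  apply: nonvanishing_lin => //; rewrite /psi aj eqxx co_eb ?eqxx //.
  by rewrite (polC fr (eb k.+2)) pol_eb ?aj ?mulr0 ?subr0 ?mulr1.
have nB : nonvanishing fr k.+1 (fun z => B z b) by exists a, b; split.
have lc := form_lin (co_lin fr k.+2).
have lb := form_lin (pol_lin A b).
have lp := form_lin lpsi.
have k2 := ltn0Sn k.
(* [z] is a provisional second point of the line; the factors other than [g] make the equation for
   the node solvable with a nonzero root. *)
have [z [u [fz _ qz _]]] :
    nonvanishing fr k.+1 (fun z => g z * (B z b * (psi z * co k.+2 z))).
  apply: (nonvanishingM k2 kn Hg (formM lb (formM lp lc)) ng).
  apply: (nonvanishingM k2 kn lb (formM lp lc) nB).
  by apply: (nonvanishingM k2 kn lp lc npsi); apply: nonvanishing_co.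
rewrite !mulf_eq0 !negb_or => /and4P[gz Bzb psiz zj].
(* Half of the condition that the mirror image of [z] with respect to [x *: a + b] lies in H. The
   constant term is nonzero, which forces [x != 0] and hence a node off the quadric. *)
have [x Hx] : exists x, - (B z b * co k.+2 b) +
    (B a b * co k.+2 z - B z a * co k.+2 b - B z b * co k.+2 a) * x +
    (- (B z a * co k.+2 a)) * x ^+ 2 = 0.
  apply: quadratic_root; move: psiz; rewrite /psi oppr_eq0 mulf_eq0 negb_or.
  have [->|aj ->] := eqVneq (co k.+2 a) 0; last by rewrite orbT.
  by rewrite mulr0 subr0 (mulrC (co k.+2 b)) => ->.
pose o := x *: a + 1 *: b.
have fo : flag k.+1 o by apply: flagD; apply: flagZ.
have qo : q o = 2 * x * B a b by rewrite qform_lc // mulr1.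
have x0 : x != 0.
  apply/eqP => x0; move/eqP: Hx; rewrite x0 mulr0 expr0n mulr0 !addr0 oppr_eq0.
  by rewrite mulf_eq0 (negPf Bzb) (negPf bj).
have qo0 : q o != 0 by rewrite qo !mulf_neq0.
have oj : co k.+2 o = x * co k.+2 a + co k.+2 b.
  by rewrite (linD (co_lin fr k.+2)) !(linZ (co_lin fr k.+2)) mul1r.
have Bzo : B z o = x * B z a + B z b by rewrite !(polE fr) mul1r.
have Heq : q o * co k.+2 z = 2 * B z o * co k.+2 o.
  apply/eqP; rewrite -subr_eq0 qo Bzo oj; apply/eqP.
  rewrite -[RHS](mulr0 2) -Hx; ring.
have [Bzo0 oj0] : B z o != 0 /\ co k.+2 o != 0.
  have : q o * co k.+2 z != 0 by rewrite mulf_neq0.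
  by rewrite Heq !mulf_eq0 !negb_or => /andP[/andP[_ ->] ->].
pose u0 := refl A o z.
have fu0 : flag k.+1 u0 by apply: flag_refl.
have u0j : co k.+2 u0 = 0.
  rewrite /u0 /refl -scaleNr (linD (co_lin fr k.+2)) !(linZ (co_lin fr k.+2)) Heq; ring.
have fu0k : flag k u0 by apply: flag_last.
have qu0 : q u0 = 0 by rewrite (qform_refl fr) qz mulr0.
have Bu0 : B u0 o != 0 by rewrite pol_refl_axis oppr_eq0 mulf_neq0.
(* The witness that [u0] is off the vertex must lie in H; dropping the last coordinate of [o] does
   not change its pairing with [u0]. *)
pose o' := o - co k.+2 o *: eb k.+2.
have fo' : flag k o'.
  apply: flag_last => //.
    by rewrite /o' -scaleNr; apply: flagD => //; apply: flagZ; apply: flag_eb.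
  rewrite /o' -scaleNr (linD (co_lin fr k.+2)) (linZ (co_lin fr k.+2)) co_eb ?eqxx //.
  by rewrite mulr1 subrr.
have Bu0' : B u0 o' != 0.
  by rewrite /o' pol_subZ pol_eb // u0j !mulr0 subr0.
(* The mirror image of [u0] is a multiple of [z], where [g] is nonzero. So with this node the mirror
   image of a generic point of the quadric in H avoids the zeros of [g]. *)
have nG : nonvanishing fr k (fun v => g (refl A o v)).
  exists u0, o'; split=> //; rewrite /u0 reflK (form_homog Hg) mulf_neq0 //.
  by rewrite !expf_neq0.
have nBo : nonvanishing fr k (fun v => B v o) by exists u0, o'; split.
have HgR := form_refl A o Hg.
have [w [_ [fw _ qw _]]] :
    nonvanishing fr k (fun v => f v * (g (refl A o v) * B v o)).
  have lB := form_lin (pol_lin A o).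
  apply: (nonvanishingM k0 k1 Hf (formM HgR lB) nf).
  exact: (nonvanishingM k0 k1 HgR lB nG nBo).
rewrite !mulf_eq0 !negb_or => /and3P[fw0 gw0 Bwo].
have wj : co k.+2 w = 0 by apply: fw.
have fw1 : flag k.+1 w by apply: flag_le (leqnSn k) _.
exists w, (refl A o w); split=> //.
- exact: okpair_refl.
- rewrite /refl -scaleNr (linD (co_lin fr k.+2)) !(linZ (co_lin fr k.+2)) wj mulr0 add0r.
  by rewrite mulf_neq0 // oppr_eq0 mulf_neq0.
by exists o; split=> //; [apply: on_pair_axis | exists x, 1].
Qed.

End Chains.

(** * Degenerate chains with points of maximal rank *)

Section MaximalRank.
Variables (F : closedFieldType) (n : nat) (A : 'M[F]_(n.+1)) (fr : frame A).
Local Notation vec := 'rV[F]_(n.+1).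
Local Notation B := (qpolar A).
Local Notation q := (qform A).
Local Notation co := (co fr).
Local Notation eb := (eb fr).
Local Notation cc := (cc fr).
Local Notation flag := (flag fr).
Local Notation chain := (chain fr).
Local Notation okpair := (okpair fr).
Local Notation h k t := (size (words k t)).

(** Each new line gives one point to [ns], counted in degree [t], and one to [fs], counted in degree
    [t.+1] in H. The two bounds leave room for the forms [g] and [f] that these points must avoid.
    The point off H stays second in the leading pair, as the next step requires. *)
Lemma near_far_extend k t m C (ns fs : seq vec) p : (0 < k)%N -> (k.+1 < n)%N ->
  chain k.+1 (p :: C) -> co k.+2 p.2 != 0 -> perm_eq (pts (p :: C)) (ns ++ fs) ->
  independent t ns -> independent t.+1 fs ->
  (forall z, z \in ns -> co k.+2 z != 0) -> (forall z, z \in fs -> flag k z) ->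
  (size ns + m <= h k.+1 t)%N -> (size fs + m <= h k t.+1)%N ->
  exists D, [/\ size D = (size C).+1 + m, chain k.+1 D & independent t.+1 (pts D)]%N.
Proof.
move=> k0 kn; elim: m C ns fs p => [|m IH] C ns fs p HC pj Hperm Hns Hfs nsj fsj sn sf.
  exists (p :: C); split=> //=; first by rewrite addn0.
  rewrite perm_sym in Hperm; apply: (independent_perm Hperm).
  apply: (@independent_union _ _ _ fr t k.+2) => // z /fsj; apply; lia.
have [|g [Hg gz ng]] := @exists_form_vanishing _ _ _ fr k.+1 t ns kn; first by lia.
have [|f [Hf fz nf]] := @exists_form_vanishing _ _ _ fr k t.+1 fs (ltnW kn); first by lia.
have okp : okpair k.+1 (p.1, p.2) by rewrite -surjective_pairing; case: HC.
have [u [v [Huv fu vj Hl [fu0 gv0]]]] := near_far_step k0 kn okp pj Hf nf Hg ng.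
have [|||||||||D [sD HD ID]] := IH (p :: C) (v :: ns) (u :: fs) (u, v).
- by split=> //; rewrite -surjective_pairing in Hl.
- exact: vj.
- apply: (@perm_trans _ [:: u, v & ns ++ fs]); first by rewrite !perm_cons.
  by rewrite perm_sym perm_catC /= perm_cons perm_catC.
- exact: (independent_cons Hns Hg gz gv0).
- exact: (independent_cons Hfs Hf fz fu0).
- by move=> z; rewrite inE => /orP[/eqP->|/nsj].
- by move=> z; rewrite inE => /orP[/eqP->|/fsj].
- by move: sn => /=; lia.
- by move: sf => /=; lia.
by exists D; split=> //; rewrite sD /=; lia.
Qed.

Lemma glue_chains k t m C1 C2 : (k.+1 < n)%N -> (0 < size C1)%N -> (0 < size C2)%N ->
  chain k.+1 C1 -> independent t (pts C1) -> chain k C2 -> independent t.+1 (pts C2) ->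
  ((size C1).*2 + m <= h k.+1 t)%N -> ((size C2).*2 + m <= h k t.+1)%N ->
  (m == 0)%N || (0 < k)%N ->
  exists D, [/\ size D = size C1 + size C2 + m, chain k.+1 D & independent t.+1 (pts D)]%N.
Proof.
move=> kn; case: C1 => // p C; case: C2 => // p' C' _ _ HC I1 HC' I2 s1 s2 Hm.
have [[|e D] [sD HD off ID]] := join_chains kn HC HC'; first by [].
have flagC' z : z \in pts (p' :: C') -> flag k z.
  by move=> /(chain_pts HC')[].
have [m0|k0] : m = 0%N \/ (0 < k)%N by case/orP: Hm => [/eqP|]; [left|right].
  exists ((e :: D) ++ p' :: C'); split=> //.
    by rewrite size_cat sD m0 addn0.
  rewrite pts_cat; apply: (@independent_union _ _ _ fr t k.+2) => //; first exact: ID.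
  by move=> z /flagC'; apply; lia.
have [||||||||E [sE HE IE]] := @near_far_extend k t m (D ++ p' :: C')
    (pts (e :: D)) (pts (p' :: C')) e k0 kn HD.
- by apply: off; rewrite /= !inE eqxx orbT.
- by rewrite -pts_cat.
- exact: ID.
- exact: I2.
- exact: off.
- exact: flagC'.
- by rewrite size_pts sD.
- by rewrite size_pts.
by exists E; split=> //; rewrite sE size_cat; move: sD => /=; lia.
Qed.

Lemma sizeS_words k t : h k.+1 t.+1 = (h k t.+1 + h k.+1 t)%N.
Proof. by rewrite wordsS size_cat size_map. Qed.

Lemma size_words1 k : h k 1 = k.+2.
Proof. by elim: k => // k IH; rewrite sizeS_words IH words0 addn1. Qed.

Lemma size_words_conic t : h 1 t = t.*2.+1.
Proof. by elim: t => // t IH; rewrite sizeS_words IH words0S /= doubleS. Qed.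

Lemma size_words2_ge k : (k.+4 <= h k.+1 2)%N.
Proof.
elim: k => [|k IH]; first by rewrite size_words_conic.
by rewrite sizeS_words size_words1; lia.
Qed.

(** More conditions than the [t.*2] points of a chain of [t] lines; in particular half-filled chains
    are nonempty in positive degree. *)
Lemma size_words_gt k t : (t.*2 < h k.+1 t)%N.
Proof.
elim: k t => [|k IH] t; first by rewrite size_words_conic.
by case: t => [|t]; [rewrite words0 | rewrite sizeS_words; have := IH t.+1; lia].
Qed.

Lemma independent_pair k t p : okpair k p -> independent t.+1 (pts [:: p]).
Proof.
move=> [_ _ q1 q2 B12].
have I0 : independent t.+1 ([::] : seq vec).
  by split=> // v; exists (fun=> 0); rewrite //; apply: form_zero.
have I1 : independent t.+1 [:: p.2].
  apply: (independent_cons I0 (formX t.+1 (pol_lin A p.1))) => //.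
  by rewrite (polC fr) expf_neq0.
apply: (independent_cons I1 (formX t.+1 (pol_lin A p.2))); last by rewrite expf_neq0.
by move=> y; rewrite inE => /eqP->; rewrite -qE q2 expr0n.
Qed.

Lemma okpair01 k : (k < n)%N -> okpair k (eb 0, eb 1).
Proof.
move=> kn; split=> /=; [exact: flag_eb0|exact: flag_eb1|exact: q_eb0|exact: q_eb1|].
by rewrite pol_eb01 oner_neq0.
Qed.

(* The maximal number of lines for which the points can be independent. *)
Definition half_filled k t :=
  exists C, [/\ size C = (h k t)./2, chain k C & independent t (pts C)].

Lemma half_filled_line t : (0 < n)%N -> half_filled 0 t.+1.
Proof.
move=> n0; exists [:: (eb 0, eb 1)]; split=> //.
  by split=> //; apply: okpair01.
exact: (independent_pair _ (okpair01 n0)).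
Qed.

(** The [t.*2.+1] conditions grow by two with the degree, and the line through [eb 0] and [eb 1]
    accounts for them without mixed lines. *)
Lemma half_filled_conic t : half_filled 1 t.+1.
Proof.
have n1 : (1 < n)%N by have := frame_dim fr; lia.
elim: t => [|t [C1 [s1 HC1 I1]]].
  exists [:: (eb 0, eb 1)]; split=> //.
    by split=> //; apply: okpair01.
  exact: (independent_pair _ (okpair01 n1)).
have [C2 [s2 HC2 I2]] := half_filled_line t.+1 (ltnW n1).
rewrite /= in s2; rewrite size_words_conic /= in s1.
have [|||||||||D [sD HD ID]] := @glue_chains 0 t.+1 0 C1 C2 n1; rewrite ?s1 ?s2 //.
  by rewrite size_words_conic; lia.
exists D; split=> //; rewrite sD s1 s2 size_words_conic; lia.
Qed.

(** Double induction on the dimension and the degree; degree 2 is treated apart, as it would rest on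
    chains that are half-filled in degree 1. *)
Lemma half_filledP k t : (0 < k)%N -> (k < n)%N -> half_filled k t.+2.
Proof.
case: k => // k _; elim: k t => [|k IHk] t kn; first exact: half_filled_conic.
elim: t => [|t [C1 [s1 HC1 I1]]].
  have ok1 := okpair01 kn.
  have [C2 [s2 HC2 I2]] := IHk 0%N (ltnW kn).
  (* [C2] is shortened to leave room in H for one point of each of [k.+2] mixed lines. Their other
     points, with the two of the single line off H, fill the [k.+4] conditions of degree 1. *)
  pose m := (h k.+1 2 - k.+2)./2.
  have hk := size_words2_ge k.
  have sm : size (take m C2) = m.
    by rewrite size_take s2; case: ltnP => //; rewrite /m; lia.
  have [|||||||||D [sD HD ID]] :=
      @glue_chains k.+1 1 k.+2 [:: (eb 0, eb 1)] (take m C2) kn; rewrite ?sm //.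
  - by rewrite /m; lia.
  - exact: (independent_pair _ ok1).
  - exact: chain_take.
  - by apply: (independent_sub I2); [apply: uniq_pts_take; case: I2 | apply: pts_take].
  - by rewrite size_words1 /=; lia.
  - by rewrite /m; lia.
  exists D; split=> //; rewrite sD sm (sizeS_words k.+1 1) size_words1 [size [:: _]]/= /m; lia.
have [C2 [s2 HC2 I2]] := IHk t.+1 (ltnW kn).
have g1 := size_words_gt k.+1 t.+2; have g2 := size_words_gt k t.+3.
(* One mixed line exactly when both sides have an odd condition left over. *)
pose m : nat := odd (h k.+2 t.+2) && odd (h k.+1 t.+3).
have [|||||||||D [sD HD ID]] := @glue_chains k.+1 t.+2 m C1 C2 kn; rewrite ?s1 ?s2 //.
- by lia.
- by lia.
- rewrite /m; case: (odd (h k.+1 _)); rewrite ?andbT ?andbF; lia.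
- rewrite /m; case: (odd (h k.+2 _)); rewrite ?andbT ?andbF /=; lia.
- by rewrite orbT.
exists D; split=> //; rewrite sD s1 s2 (sizeS_words k.+1 t.+2) halfD /m andbC.
by rewrite addnC (addnC (h k.+2 t.+2)./2).
Qed.

(** Join a generic point of the quadric to a node on [p]. This supplies the last point when the
    number of conditions is odd. *)
Lemma nonvanishing_link k p t f : (0 < k)%N -> (k < n)%N -> okpair k p ->
  pform t f -> nonvanishing fr k f ->
  exists u v, [/\ okpair k (u, v), link A (u, v) p & f u != 0].
Proof.
move=> k0 kn okp Hf nf; have [o [op qo fo]] := unit_node okp.
have [x [y Eo]] := op.
have nB : nonvanishing fr k (fun v => B v o).
  have [f1 f2 q1 q2 B12] := okp.
  have [B1|B1] := eqVneq (B p.1 o) 0; last by exists p.1, p.2; split.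
  exists p.2, p.1; split=> //; first by rewrite (polC fr).
  apply/eqP => B2; have : q o = 0 by rewrite qE {1}Eo !(polE fr) B1 B2 !mulr0 addr0.
  by rewrite qo => /eqP; rewrite oner_eq0.
have [w [_ [fw _ qw _]]] :=
    nonvanishingM k0 kn Hf (form_lin (pol_lin A o)) nf nB.
rewrite mulf_eq0 negb_or => /andP[fw0 Bwo].
exists w, (refl A o w); split=> //; first exact: okpair_refl.
by exists o; split; rewrite ?qo ?oner_neq0 //; apply: on_pair_axis.
Qed.

Lemma linkxx k p : okpair k p -> link A p p.
Proof. by move=> /unit_node[o [? qo ?]]; exists o; rewrite qo oner_neq0. Qed.

(** Copies of a line lengthen a chain without adding points; a line is linked to itself by any of
    its points off the quadric. *)
Lemma chain_nseq k m p C : chain k (p :: C) -> chain k (nseq m p ++ p :: C).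
Proof.
move=> HC; have okp : okpair k p by case: HC.
elim: m => [//|m IH]; split=> //.
by case: m {IH} => [|m] /=; apply: linkxx okp.
Qed.

Lemma chain_star k o C : q o != 0 ->
  (forall p, p \in C -> okpair k p /\ on_pair o p) -> chain k C.
Proof.
move=> qo; elim: C => [|p C IH] //= HC.
have [okp op] := HC p (mem_head _ _); split=> //; last first.
  by apply: IH => p' Hp'; apply: HC; rewrite inE Hp' orbT.
case: C HC {IH} => //= p' C HC; exists o; split=> //.
by have [] := HC p' _; rewrite // !inE eqxx orbT.
Qed.

(** * Evaluation matrices, and the choice of a chain in each degree *)

Local Notation K := n.-1.

(** Injectivity of the restriction to [zs], expressed in the basis of forms modulo the quadric. *)
Definition separating t (zs : seq vec) := forall c,
  (forall z, z \in zs -> lcomb fr (words K t) c z = 0) ->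
  forall i, (i < h K t)%N -> c i = 0.

(** The number of columns is an argument, so that the matrices of a varying chain have one fixed
    type. *)
Definition evalmx t m (zs : seq vec) :=
  \matrix_(i < h K t, j < m) monom fr (nth [::] (words K t) i) (nth 0 zs j).

Lemma lcomb_evalmx t m zs (u : 'rV_(h K t)) (c : nat -> F) (j : 'I_m) :
  (forall i : 'I_(h K t), c i = u 0 i) ->
  lcomb fr (words K t) c (nth 0 zs j) = (u *m evalmx t m zs) 0 j.
Proof.
move=> cu; rewrite mxE /lcomb big_mkord; apply: eq_bigr => i _.
by rewrite cu mxE.
Qed.

Lemma row_free_evalmx t m zs : size zs = m -> separating t zs ->
  row_free (evalmx t m zs).
Proof.
move=> sz Hs; rewrite -kermx_eq0; apply/eqP/row_matrixP => l; rewrite row0.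
set u := row l _; have uM : u *m evalmx t m zs = 0.
  by rewrite /u -row_mul mulmx_ker row0.
pose c i := if insub i is Some j then u 0 j else 0.
have cE (j : 'I_(h K t)) : c j = u 0 j by rewrite /c valK.
apply/rowP => i; rewrite [RHS]mxE -cE; apply: Hs => // z /(nthP 0)[j Hj <-].
by rewrite sz in Hj; rewrite (lcomb_evalmx zs (Ordinal Hj) cE) uM mxE.
Qed.

Lemma separating_evalmx t m zs : size zs = m -> row_free (evalmx t m zs) ->
  separating t zs.
Proof.
move=> sz Hf c Hc i Hi; pose u := \row_(i < h K t) c i.
have: u *m evalmx t m zs = 0.
  apply/rowP => j; rewrite [RHS]mxE -(@lcomb_evalmx t m zs u c j) => [|l]; last by rewrite mxE.
  by apply: Hc; apply: mem_nth; rewrite sz.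
move/eqP; rewrite mulmx_free_eq0 // => /eqP/rowP/(_ (Ordinal Hi)).
by rewrite !mxE.
Qed.

(** A relation between the evaluations at [us] holds for every form, and forms that are nonzero at
    exactly one point kill its coefficients one by one. Points enter up to scalars because the
    parametrization reaches a chain only in this sense. *)
Lemma row_free_evalmx_tr t m (zs us : seq vec) : size zs = m ->
  (forall z, z \in zs -> q z = 0) -> independent t zs ->
  (forall j, (j < size zs)%N -> exists2 a, a != 0 & nth 0 us j = a *: nth 0 zs j) ->
  row_free (evalmx t m us)^T.
Proof.
move=> sz qz [uz Hz] Hs; rewrite -kermx_eq0; apply/eqP/row_matrixP => l; rewrite row0.
set u := row l _; have uM : u *m (evalmx t m us)^T = 0.
  by rewrite /u -row_mul mulmx_ker row0.
apply/rowP => j; rewrite [RHS]mxE.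
have Hj : (j < size zs)%N by rewrite sz ltn_ord.
have [f Hf fz] := Hz (fun z => (z == nth 0 zs j)%:R).
have [c Hc] := form_lcombE fr Hf.
have fu (i : 'I_m) : exists2 a, (i == j -> a != 0) & f (nth 0 us i) = a * (i == j)%:R.
  have Hi : (i < size zs)%N by rewrite sz ltn_ord.
  have [a a0 ->] := Hs i Hi; exists (a ^+ t); first by rewrite expf_neq0.
  by rewrite (form_homog Hf) fz ?mem_nth // nth_uniq.
have fE (i : 'I_m) : f (nth 0 us i) = \sum_(l < h K t) c l * evalmx t m us l i.
  have Hi : (i < size zs)%N by rewrite sz ltn_ord.
  rewrite Hc /lcomb ?big_mkord; last first.
    have [a _ ->] := Hs i Hi; rewrite qE polZl (polZr fr) -qE.
    by rewrite qz ?mem_nth // !mulr0.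
  by apply: eq_bigr => i' _; rewrite mxE.
have: \sum_i u 0 i * f (nth 0 us i) = 0.
  under eq_bigr => i _ do rewrite fE mulr_sumr.
  rewrite exchange_big big1 // => l' _ /=.
  have /rowP/(_ l') := uM; rewrite !mxE => H.
  transitivity (c l' * \sum_i u 0 i * (evalmx t m us)^T i l'); last by rewrite H mulr0.
  by rewrite mulr_sumr; apply: eq_bigr => i _; rewrite [_^T i l']mxE mulrCA.
rewrite (bigD1 j) //= big1 ?addr0 => [|i ij].
  have [a /(_ (eqxx _)) a0 ->] := fu j; rewrite eqxx mulr1 => /eqP.
  by rewrite mulf_eq0 (negPf a0) orbF => /eqP.
by have [a _ ->] := fu i; rewrite (negPf ij) !mulr0.
Qed.

Lemma independent_separating t zs : (forall z, z \in zs -> q z = 0) ->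
  independent t zs -> size zs = h K t -> separating t zs.
Proof.
move=> qz Iz sz; apply: (separating_evalmx sz).
have Hf : row_free (evalmx t (h K t) zs)^T.
  apply: (row_free_evalmx_tr sz) => // j _.
  by exists 1; rewrite ?oner_neq0 // scale1r.
by move: Hf; rewrite /row_free mxrank_tr.
Qed.

Lemma separating_sub t zs us : {subset zs <= us} -> separating t zs -> separating t us.
Proof. by move=> Hs H c Hc; apply: H => z /Hs; apply: Hc. Qed.

Lemma form1_lin f : @pform F n 1 f -> lin f.
Proof.
have H0 t g : pform t g -> t = 0%N -> exists c, forall v : vec, g v = c.
  elim=> {t g} // [c g Hg _|t g1 g2 g _ IH1 _ IH2 Hg t0]; first by exists c.
  have [c1 H1] := IH1 t0; have [c2 H2] := IH2 t0.
  by exists (c1 + c2) => v; rewrite Hg H1 H2.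
move E1 : 1%N => t Hf; elim: Hf E1 => {t f} // [t g1 g2 g _ IH1 _ IH2 Hg t1|].
  have [w Hw] := lin_add (IH1 t1) (IH2 t1).
  by exists w => v; rewrite Hg Hw.
move=> t l g g' Hl Hg _ Hg' [t0]; have [c Hc] := H0 t g Hg (esym t0).
have [w Hw] := lin_scale c Hl; exists w => v.
by rewrite -Hw Hg' Hc mulrC.
Qed.

Lemma mem_pts1 (C : seq (vec * vec)) p : p \in C -> p.1 \in pts C.
Proof.
elim: C => //= p' C IH; rewrite !inE => /orP[/eqP<-|/IH->]; last by rewrite !orbT.
by rewrite eqxx.
Qed.

(** The common point is [eb 0 + eb 1]. The points [eb 0], [eb 1] and the [n.-1] spikes span the
    whole space, so no nonzero linear form vanishes at all of them. *)
Lemma star_separating d : (n <= d)%N ->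
  exists C, [/\ size C = d, chain K C & separating 1 (pts C)].
Proof.
move=> nd; have n3 := frame_dim fr; have Kn : (K < n)%N by lia.
pose P i := (spike fr i 1, refl A (eb 0 + eb 1) (spike fr i 1)).
pose S := [seq P i | i <- iota 2 n.-1].
exists (nseq (d - n) (eb 0, eb 1) ++ (eb 0, eb 1) :: S).
have sp i : (2 <= i < n.+1)%N -> [/\ q (spike fr i 1) = 0,
    B (spike fr i 1) (eb 0 + eb 1) != 0 & flag K (spike fr i 1)].
  move=> Hi; have [q0 B1 B0 _ fl] := spikeP fr Hi (expr1n F 2); split=> //.
    (* The pairing is [1 - 2 * cc i], which is 1 or -1. *)
    rewrite (polDr fr) B0 B1; have [->|->] := cc01 fr i.
      by rewrite mulr0 oppr0 add0r oner_neq0.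
    rewrite mulr1 (_ : - 2 + 1 = -1 :> F); last by ring.
    by rewrite oppr_eq0 oner_neq0.
  by apply: flag_le fl; lia.
split.
- by rewrite size_cat size_nseq /= size_map size_iota; lia.
- apply: chain_nseq; apply: (@chain_star _ (eb 0 + eb 1)).
    rewrite -[eb 0]scale1r -[eb 1]scale1r (qform_lc fr) ?q_eb0 ?q_eb1 //.
    by rewrite pol_eb01 !mulr1 (two_neq0 fr).
  move=> p; rewrite inE => /orP[/eqP->|/mapP[i]].
    split; first exact: okpair01.
    by exists 1, 1; rewrite !scale1r.
  rewrite mem_iota => Hi ->; have [|q0 B0 fl] := sp i; first by lia.
  split; last exact: on_pair_axis.
  apply: okpair_refl => //; apply: flagD; first exact: flag_eb0.
  exact: flag_eb1.
move=> c Hc i Hi; apply/eqP/negPn/negP => ci.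
have [|a [u [_ _ _ _ fa]]] := @lcomb_nonvanishing _ _ _ fr K 1 c Kn; first by exists i.
have Hl : lin (lcomb fr (words K 1) c) by apply: form1_lin; apply: form_lcomb.
set f := lcomb _ _ c in Hc Hl fa.
have sub z : z \in [:: eb 0, eb 1 & pts S] -> f z = 0.
  by move=> Hz; apply: Hc; rewrite pts_cat mem_cat Hz orbT.
have f0 : f (eb 0) = 0 by apply: sub; rewrite inE eqxx.
have f1 : f (eb 1) = 0 by apply: sub; rewrite !inE eqxx orbT.
have fe (j : 'I_n.+1) : f (eb j) = 0.
  case: j => [[|[|j]]] //= Hj.
  have : f (spike fr j.+2 1) = 0.
    apply: sub; rewrite !inE; apply/orP; right; apply/orP; right.
    by apply: (@mem_pts1 _ (P j.+2)); apply: map_f; rewrite mem_iota; lia.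
  rewrite /spike -scaleNr !(linD Hl, linZ Hl) f0 f1 mulr0 !add0r mulr1.
  by move/eqP; rewrite mulf_eq0 (negPf (two_neq0 fr)) => /eqP.
case/eqP: fa; rewrite (vec_eb fr a); elim/big_ind: _ => [|x y fx fy|j _].
- by rewrite -(scale0r (0 : vec)) (linZ Hl) mul0r.
- by rewrite (linD Hl) fx fy addr0.
by rewrite (linZ Hl) fe mulr0.
Qed.

(** In degree 0 one point suffices. From degree 2 on, a half-filled chain is cut to [d] lines, which
    keeps independence, or lengthened to [d] lines by copies, which keeps separation. If the number
    of conditions is odd, one more line is inserted first, of which a single point is used. *)
Lemma maximal_rank_chain d t : (n <= d)%N ->
  exists C, [/\ size C = d, chain K C & separating t (pts C) \/ independent t (pts C)].
Proof.
move=> nd; have n3 := frame_dim fr; have Kn : (K < n)%N by lia.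
have K0 : (0 < K)%N by lia.
case: t => [|[|t]].
- exists (nseq (d.-1) (eb 0, eb 1) ++ [:: (eb 0, eb 1)]); split.
  + by rewrite size_cat size_nseq /=; lia.
  + by apply: chain_nseq; split=> //; apply: okpair01.
  left=> c Hc i; rewrite {1}words0; case: i => // _.
  have := Hc (eb 0); rewrite pts_cat mem_cat /= !inE eqxx orbT => /(_ isT).
  by rewrite /lcomb words0 big_nat1 /monom big_nil mulr1.
- by have [C [sC HC Hs]] := star_separating nd; exists C; split=> //; left.
have [C [sC HC IC]] := half_filledP t K0 Kn.
have [dh|dh] := leqP d (h K t.+2)./2.
  exists (take d C); split; first by rewrite size_take sC; case: ltnP => //; lia.
    exact: chain_take.
  right; apply: (independent_sub IC); first by apply: uniq_pts_take; case: IC.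
  exact: pts_take.
have h2 : (t.+2.*2 < h K t.+2)%N by case: (K) K0 => // k _; apply: size_words_gt.
have qC z : z \in pts C -> q z = 0 by move=> /(chain_pts HC)[].
have fill E : chain K E -> (0 < size E)%N -> (size E <= d)%N -> separating t.+2 (pts E) ->
    exists C, [/\ size C = d, chain K C &
      separating t.+2 (pts C) \/ independent t.+2 (pts C)].
  case: E => // p E HE _ sE Hs; exists (nseq (d - (size E).+1) p ++ p :: E); split.
  - by rewrite size_cat size_nseq /= subnK.
  - exact: chain_nseq.
  left; apply: separating_sub Hs => z Hz; by rewrite pts_cat mem_cat Hz orbT.
have [oh|eh] := boolP (odd (h K t.+2)); last first.
  apply: (fill C) => //; try (rewrite sC; lia).
  by apply: independent_separating => //; rewrite size_pts sC; lia.
case: C sC HC IC qC => [|p C] sC HC IC qC; first by move: sC => /=; lia.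
have [|f [Hf fz nf]] := @exists_form_vanishing _ _ _ fr K t.+2 (pts (p :: C)) Kn.
  by rewrite size_pts sC; lia.
have [|u [v [okuv Huv fu]]] := @nonvanishing_link K p _ f K0 Kn _ Hf nf; first by case: HC.
have HC' : chain K ((u, v) :: p :: C) by split.
apply: (fill _ HC') => //; first by move: sC dh => /= ->; lia.
apply: (@separating_sub _ (u :: pts (p :: C))).
  by move=> z; rewrite /= !inE => /orP[->|->]; rewrite ?orbT.
apply: independent_separating.
- by move=> z; rewrite inE => /orP[/eqP->|/qC//]; case: okuv.
- exact: (independent_cons IC Hf fz fu).
by rewrite -[size _]/((size (pts (p :: C))).+1) size_pts sC; lia.
Qed.

End MaximalRank.

(** * Generic properties *)

Section Generic.
Variables (F : closedFieldType) (X : lmodType F).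

Definition generic (P : X -> Prop) := exists G,
  [/\ polyfun G, exists x, G x != 0 & forall x, G x != 0 -> P x].

Lemma generic_neq0 (G : X -> F) x : polyfun G -> G x != 0 -> generic (fun x => G x != 0).
Proof. by move=> pG Gx; exists G; split=> //; exists x. Qed.

Lemma generic_imp (P Q : X -> Prop) : (forall x, P x -> Q x) -> generic P -> generic Q.
Proof. by move=> PQ [G [pG nG HG]]; exists G; split=> // x /HG/PQ. Qed.

Lemma generic_and P Q : generic P -> generic Q -> generic (fun x => P x /\ Q x).
Proof.
move=> [G [pG [x Gx] HG]] [H [pH [y Hy] HH]]; exists (fun x => G x * H x); split.
- exact: polyfunM.
- exact: polyfun_common pG pH Gx Hy.
by move=> z; rewrite mulf_eq0 negb_or => /andP[/HG ? /HH].
Qed.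

Lemma generic_all (P : nat -> X -> Prop) m : (forall i, (i < m)%N -> generic (P i)) ->
  generic (fun x => forall i, (i < m)%N -> P i x).
Proof.
elim: m => [|m IH] HP.
  by exists (fun=> 1); split=> //; [apply: polyfun_cst | exists 0; apply: oner_neq0].
apply: generic_imp (generic_and (IH (fun i Hi => HP i (ltnW Hi))) (HP m (ltnSn m))).
by move=> x [H1 H2] i; rewrite ltnS leq_eqVlt => /orP[/eqP->//|/H1].
Qed.

(** A right inverse [D] at one parameter turns full rank into the nonvanishing of a single
    determinant, without a choice of minor. *)
Lemma generic_row_free m p (M : X -> 'M[F]_(m, p)) x :
  (forall i j, polyfun (fun x => M x i j)) -> row_free (M x) ->
  generic (fun x => row_free (M x)).
Proof.
move=> pM /row_freeP[D HD]; apply: (@generic_imp (fun x => \det (M x *m D) != 0)).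
  move=> y; rewrite -unitfE -/(unitmx _) => Hu; apply/row_freeP.
  by exists (D *m invmx (M y *m D)); rewrite mulmxA mulmxV.
apply: (@generic_neq0 _ x); last by rewrite HD det1 oner_neq0.
apply: polyfun_det => i j.
apply: (@polyfun_ext _ _ (fun x => \sum_k M x i k * D k j)) => [y|]; first by rewrite mxE.
by apply: polyfun_sum => k; apply: polyfunM => //; apply: polyfun_cst.
Qed.

End Generic.

(** * Chains parametrized by a vector space, and their generic member *)

Section Parametrization.
Variables (F : closedFieldType) (n : nat) (A : 'M[F]_(n.+1)) (fr : frame A).
Local Notation vec := 'rV[F]_(n.+1).
Local Notation B := (qpolar A).
Local Notation q := (qform A).
Local Notation co := (co fr).
Local Notation eb := (eb fr).
Local Notation cc := (cc fr).
Local Notation flag := (flag fr).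
Local Notation chain := (chain fr).
Local Notation okpair := (okpair fr).
Local Notation K := n.-1.
Local Notation p0 := ((0, 0) : vec * vec).

(** Two axes for a point of the quadric and a scalar for the next node; the scalar is read off an
    entry of a vector, so that all factors are copies of [vec]. *)
Fixpoint params d : lmodType F :=
  if d is d'.+1 then (vec * vec * vec * params d')%type : lmodType F else vec.

(* The lines of the chain built from a starting node [o]: the first point of each
   line is an arbitrary point of the quadric, the second one its mirror image with
   respect to the node; the next node is an arbitrary point of this line. *)
Fixpoint pchain d (o : vec) : params d -> seq (vec * vec) :=
  match d with
  | 0 => fun=> [::]
  | d'.+1 => fun x : vec * vec * vec * params d' =>
    let a := refl A x.1.1.1 (refl A x.1.1.2 (eb 0)) in
    let b := refl A o a in
    (a, b) :: pchain (b + x.1.2 0 0 *: a) x.2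
  end.

Fixpoint pnodes d (o : vec) : params d -> seq vec :=
  match d with
  | 0 => fun=> [::]
  | d'.+1 => fun x : vec * vec * vec * params d' =>
    let a := refl A x.1.1.1 (refl A x.1.1.2 (eb 0)) in
    let b := refl A o a in
    o :: pnodes (b + x.1.2 0 0 *: a) x.2
  end.

Lemma size_pchain d o x : size (@pchain d o x) = d.
Proof. by elim: d o x => //= d IH o x; rewrite IH. Qed.

(** The starting node must be allowed to vary polynomially, since after one line it is itself an
    expression in the parameters. *)
Lemma pchain_poly (X : lmodType F) d (o : X -> vec) (x : X -> params d) :
  polyvec o -> (forall s u v, x (u + s *: v) = x u + s *: x v) ->
  forall i, [/\ polyvec (fun w => (nth p0 (pchain (o w) (x w)) i).1),
                polyvec (fun w => (nth p0 (pchain (o w) (x w)) i).2) &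
                polyvec (fun w => nth 0 (pnodes (o w) (x w)) i)].
Proof.
elim: d o x => [|d IH] o x po lx i.
  by rewrite /= !nth_nil; split; apply: polyvec_cst.
pose a w := refl A (x w).1.1.1 (refl A (x w).1.1.2 (eb 0)).
have pa : polyvec a.
  apply: polyvec_refl; first by apply: polyvec_linear => s u v; rewrite lx.
  apply: polyvec_refl; first by apply: polyvec_linear => s u v; rewrite lx.
  exact: polyvec_cst.
have pb : polyvec (fun w => refl A (o w) (a w)) by apply: polyvec_refl.
case: i => [|i] //=.
apply: (IH (fun w => refl A (o w) (a w) + (x w).1.2 0 0 *: a w) (fun w => (x w).2)).
  apply: polyvecD => //; apply: polyvecZ => //.
  by apply: (@polyvec_linear _ _ _ (fun w => (x w).1.2)) => s u v; rewrite lx.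
by move=> s u v; rewrite lx.
Qed.

Lemma pchain_chain d o (x : params d) :
  (forall i, (i < d)%N -> B (nth p0 (pchain o x) i).1 (nth p0 (pchain o x) i).2 != 0) ->
  (forall i, (i < d)%N -> q (nth 0 (pnodes o x) i) != 0) ->
  chain K (pchain o x).
Proof.
have n3 := frame_dim fr.
have fK v : flag K v by move=> i Hi; exfalso; lia.
have Bo w v : q w = 0 -> B w (refl A v w) != 0 -> B w v != 0.
  move=> qw; apply: contraNneq => Bwv.
  by rewrite /refl !(polE fr) -(qE A w) qw Bwv !mulr0 subrr.
elim: d o x => [|d IH] o x // HB Hq.
set a := refl A x.1.1.1 (refl A x.1.1.2 (eb 0)).
have qa : q a = 0 by rewrite /a !(qform_refl fr) q_eb0 !mulr0.
set o' := refl A o a + x.1.2 0 0 *: a.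
split.
- split=> //=; first by rewrite (qform_refl fr) qa mulr0.
  exact: (HB 0%N).
- case: d x IH HB Hq @a qa @o' => // d x IH HB Hq a qa o'.
  exists o'; split; last exact: (Hq 1%N).
    by exists (x.1.2 0 0), 1; rewrite scale1r addrC.
  apply: on_pair_axis; first by [].
  apply: Bo; last exact: (HB 1%N).
  by rewrite !(qform_refl fr) q_eb0 !mulr0.
apply: IH => i Hi; [exact: (HB i.+1) | exact: (Hq i.+1)].
Qed.

Lemma refl_on_pair (p : vec * vec) x y : okpair K p ->
  refl A (x *: p.1 + y *: p.2) p.1 = (- (2 * y ^+ 2 * B p.1 p.2)) *: p.2.
Proof.
move=> [_ _ q1 q2 _]; rewrite /refl qform_lc // !(polE fr) -(qE A p.1) q1.
by apply/rowP => i; rewrite !mxE; ring.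
Qed.

(** Two axes reach the first point of a line; the mirror image with respect to a node on the line is
    then automatically its second point. *)
Lemma pchain_reach C o p C' : chain K C -> C = p :: C' -> on_pair o p -> q o != 0 ->
  exists x : params (size C), forall i, (i < size C)%N ->
    [/\ exists2 c, c != 0 & (nth p0 (pchain o x) i).1 = c *: (nth p0 C i).1,
        exists2 c, c != 0 & (nth p0 (pchain o x) i).2 = c *: (nth p0 C i).2 &
        q (nth 0 (pnodes o x) i) != 0].
Proof.
have n3 := frame_dim fr; have Kn : (K < n)%N by lia.
have K0 : (0 < K)%N by lia.
elim: C o p C' => // p C IH o _ _ HC [<- _] [x [y Eo]] qo.
have [okp Hl HC'] := HC; have [f1 f2 q1 q2 B12] := okp.
have [u [v [c [_ _ c0 Ea]]]] := refl_reach K0 Kn f1 f2 q1 B12.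
have y0 : y != 0.
  by apply: contraNneq qo => y0; rewrite Eo qform_lc // y0 mulr0 mul0r.
pose e := c * - (2 * y ^+ 2 * B p.1 p.2).
have e0 : e != 0.
  by rewrite mulf_neq0 // oppr_eq0 !mulf_neq0 ?expf_neq0 // (two_neq0 fr).
have Eb : refl A o (c *: p.1) = e *: p.2.
  by rewrite reflZ Eo refl_on_pair // scalerA.
have [s [z Hz]] : exists s (z : params (size C)), forall i, (i < size C)%N ->
    [/\ exists2 g, g != 0 &
          (nth p0 (pchain (e *: p.2 + s *: (c *: p.1)) z) i).1 = g *: (nth p0 C i).1,
        exists2 g, g != 0 &
          (nth p0 (pchain (e *: p.2 + s *: (c *: p.1)) z) i).2 = g *: (nth p0 C i).2 &
        q (nth 0 (pnodes (e *: p.2 + s *: (c *: p.1)) z) i) != 0].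
  case: C IH Hl HC HC' => [|p' C] IH Hl HC HC'; first by exists 0, 0.
  have [o' [[x' [y' Eo']] op' qo']] := Hl.
  have y'0 : y' != 0.
    by apply: contraNneq qo' => y'0; rewrite Eo' qform_lc // y'0 mulr0 mul0r.
  (* The scalar is chosen so that the next node of the parametrized chain is proportional to the
     prescribed node [o']. *)
  have E : e *: p.2 + (e / y' * x' / c) *: (c *: p.1) = (e / y') *: o'.
    by rewrite Eo' scalerDr !scalerA (divfK c0) (divfK y'0) addrC.
  have q' : q ((e / y') *: o') != 0.
    have ey : e / y' != 0 by rewrite mulf_neq0 ?invr_eq0.
    by rewrite qE polZl (polZr fr) mulf_neq0 // mulf_neq0.
  have := IH ((e / y') *: o') p' C HC' erefl (on_pairZ _ op') q'.
  by rewrite -E => Hz; exists (e / y' * x' / c); exact: Hz.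
have Hs : (const_mx s : vec) 0 0 = s by rewrite mxE.
exists (u, v, const_mx s, z) => -[|i] Hi /=.
  rewrite Ea Eb; split=> //; [by exists c | by exists e].
by rewrite Ea Eb Hs; apply: Hz.
Qed.

Definition rowsmx m (vs : seq vec) : 'M[F]_(m, n.+1) := \matrix_(k < m) nth 0 vs k.

Lemma mul_rowsmx m vs (u : 'rV_m) : u *m rowsmx m vs = \sum_(k < m) u 0 k *: nth 0 vs k.
Proof. by rewrite mulmx_sum_row; apply: eq_bigr => k _; rewrite rowK. Qed.

Lemma row_free_rowsmx m vs :
  (forall u : 'rV_m, \sum_(k < m) u 0 k *: nth 0 vs k = 0 -> u = 0) ->
  row_free (rowsmx m vs).
Proof.
move=> H; rewrite -kermx_eq0; apply/eqP/row_matrixP => l; rewrite row0.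
by apply: H; rewrite -mul_rowsmx -row_mul mulmx_ker row0.
Qed.

Lemma rowsmx_inj m vs (u : 'rV_m) : row_free (rowsmx m vs) ->
  \sum_(k < m) u 0 k *: nth 0 vs k = 0 -> u = 0.
Proof.
by move=> Hf; rewrite -mul_rowsmx => /eqP; rewrite mulmx_free_eq0 // => /eqP.
Qed.

Lemma row_free_rowsmx_scale m (vs us : seq vec) :
  (forall k, (k < m)%N -> exists2 c, c != 0 & nth 0 us k = c *: nth 0 vs k) ->
  row_free (rowsmx m vs) -> row_free (rowsmx m us).
Proof.
move=> Hs Hf; apply: row_free_rowsmx => u Hu.
have [c Hc] : exists c : 'I_m -> F, forall k : 'I_m, c k != 0 /\ nth 0 us k = c k *: nth 0 vs k.
  have: forall k : 'I_m, exists c, (c != 0) && (nth 0 us k == c *: nth 0 vs k).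
    by move=> k; have [c c0 ->] := Hs k (ltn_ord k); exists c; rewrite c0 eqxx.
  move=> H; exists (fun k => xchoose (H k)) => k.
  by have /andP[? /eqP ?] := xchooseP (H k).
have : \row_k (u 0 k * c k) = 0.
  apply: (rowsmx_inj Hf); rewrite -[RHS]Hu; apply: eq_bigr => k _.
  by rewrite mxE; have [_ ->] := Hc k; rewrite scalerA.
move=> /rowP H; apply/rowP => k; have := H k; rewrite !mxE => /eqP.
by rewrite mulf_eq0; have [/negPf-> _] := Hc k; rewrite orbF => /eqP.
Qed.

(* The lines [<e_0, e_1>], [<e_0 + e_1, e_2>] and [<e_2, e_3>]; the two points of
   the last one are distinct because the rank is at least 4. *)
Lemma three_lines : exists L M N, [/\ [/\ okpair K L, okpair K M & okpair K N],
  link A L M, link A M N, row_free (rowsmx 4 [:: L.1; L.2; N.1; N.2]) &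
  row_free (rowsmx 3 [:: L.1; L.2; M.1])].
Proof.
have n3 := frame_dim fr; have Kn : (K < n)%N by lia.
have fK v : flag K v by move=> i Hi; exfalso; lia.
have two := two_neq0 fr.
(* These values make [eb 0 + eb 1 + r *: eb 2], of norm [2 + r ^+ 2], and [eb 2 + s *: eb 3], of
   norm [1 + s ^+ 2], isotropic, as well as the vectors with opposite signs. *)
have [r r2] : exists r : F, r ^+ 2 = - 2.
  have [|r Hr] := @quadratic_root F 2 0 1; first by rewrite oner_neq0 orbT.
  by exists r; apply/eqP; rewrite -subr_eq0 opprK -[X in _ == X]Hr; apply/eqP; ring.
have [s s2] : exists s : F, s ^+ 2 = - 1.
  have [|s Hs] := @quadratic_root F 1 0 1; first by rewrite oner_neq0 orbT.
  by exists s; apply/eqP; rewrite -subr_eq0 opprK -[X in _ == X]Hs; apply/eqP; ring.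
have r0 : r != 0.
  by apply: contraNneq two => r0; move: r2; rewrite r0 expr0n => /esym/eqP; rewrite oppr_eq0.
have s0 : s != 0.
  by apply/eqP => s0; move: s2; rewrite s0 expr0n => /esym/eqP; rewrite oppr_eq0 oner_eq0.
have [n1 n2 n3'] : [/\ (1 < n.+1)%N, (2 < n.+1)%N & (3 < n.+1)%N] by split; lia.
have coE i j : (i < 4)%N -> (j < 4)%N -> co i (eb j) = (i == j)%:R.
  by move=> Hi Hj; rewrite co_eb //; lia.
have q0 : q (eb 0) = 0 by apply: q_eb0.
have q1 : q (eb 1) = 0 by apply: q_eb1.
have Bij i j : (i < 4)%N -> (2 <= j < 4)%N -> B (eb i) (eb j) = (i == j)%:R.
  move=> Hi Hj; rewrite pol_eb; last by lia.
  rewrite coE; [|lia|lia]; rewrite eq_sym.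
  have -> : cc j = 1 by case: j Hj => [|[|[|[|j]]]] //= _; [apply: cc2 | apply: cc3].
  by rewrite mul1r.
have B01 : B (eb 0) (eb 1) = 1 by apply: pol_eb01.
have B10 : B (eb 1) (eb 0) = 1 by rewrite (polC fr).
have B02 : B (eb 0) (eb 2) = 0 by rewrite Bij.
have B12 : B (eb 1) (eb 2) = 0 by rewrite Bij.
have B20 : B (eb 2) (eb 0) = 0 by rewrite (polC fr).
have B21 : B (eb 2) (eb 1) = 0 by rewrite (polC fr).
have B22 : B (eb 2) (eb 2) = 1 by rewrite Bij.
have B23 : B (eb 2) (eb 3) = 0 by rewrite Bij.
have B32 : B (eb 3) (eb 2) = 0 by rewrite Bij.
have B33 : B (eb 3) (eb 3) = 1 by rewrite Bij.
have B00 : B (eb 0) (eb 0) = 0 by apply: q0.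
have B11 : B (eb 1) (eb 1) = 0 by apply: q1.
have BE := (B00, B01, B02, B10, B11, B12, B20, B21, B22, B23, B32, B33).
pose m x := eb 0 + eb 1 + x *: eb 2; pose p x := eb 2 + x *: eb 3.
have Bm x y : B (m x) (m y) = 2 + x * y.
  by rewrite /m !(polDr fr, polDl, polZr fr, polZl) !BE; ring.
have Bp x y : B (p x) (p y) = 1 + x * y.
  by rewrite /p !(polDr fr, polDl, polZr fr, polZl) !BE; ring.
exists (eb 0, eb 1), (m r, m (- r)), (p s, p (- s)); split.
- split; first exact: okpair01.
    split=> //=; rewrite ?qE Bm ?mulNr ?mulrN ?opprK -?expr2 ?r2 ?subrr //.
    by rewrite (_ : 2 - - 2 = 2 * 2 :> F) ?mulf_neq0 //; ring.
  split=> //=; rewrite ?qE Bp ?mulNr ?mulrN ?opprK -?expr2 ?s2 ?subrr //.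
  by rewrite opprK (_ : 1 + 1 = 2 :> F) //; ring.
- exists (eb 0 + eb 1); split.
  + by exists 1, 1; rewrite !scale1r.
  + by exists 2^-1, 2^-1; rewrite /m; apply/rowP => i; rewrite !mxE; field.
  by rewrite qE !(polDr fr, polDl) !BE !(add0r, addr0).
- exists (eb 2); split.
  + exists (2 * r)^-1, (- (2 * r)^-1); rewrite /m; apply/rowP => i; rewrite !mxE.
    by field; rewrite two r0.
  + by exists 2^-1, 2^-1; rewrite /p; apply/rowP => i; rewrite !mxE; field.
  by rewrite qE B22 oner_neq0.
- have simp := (@mul0r F, @mulr0 F, @mulr1 F, @add0r F, @addr0 F, @oppr0 F).
  apply: row_free_rowsmx => u; rewrite !big_ord_recl big_ord0 /= addr0.
  set u0 := u 0 ord0; set u1 := u 0 _; set u2 := u 0 _; set u3 := u 0 _ => Hu.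
  have H i : (i < 4)%N -> u0 * (i == 0)%:R + (u1 * (i == 1)%:R +
      (u2 * ((i == 2)%:R + s * (i == 3)%:R) + u3 * ((i == 2)%:R - s * (i == 3)%:R))) = 0.
    move=> Hi; have := congr1 (co i) Hu; rewrite (co0 fr) => <-.
    by rewrite /p !(linD (co_lin fr i), linZ (co_lin fr i)) !coE // mulNr.
  have := H 0%N isT; rewrite /= !simp => u00.
  have := H 1%N isT; rewrite /= !simp => u10.
  have := H 2 isT; rewrite /= !simp => E2.
  have := H 3 isT; rewrite /= !simp => E3.
  have u23 : u2 = u3.
    apply/eqP; rewrite -subr_eq0 -(mulIr_eq0 _ (mulIf s0)) mulrBl -[X in _ == X]E3.
    by rewrite mulrN.
  have u20 : u2 = 0.
    by move/eqP: E2; rewrite -u23 -mulr2n -mulr_natl mulf_eq0 (negPf two) => /eqP.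
  have u30 : u3 = 0 by rewrite -u23.
  apply/rowP => k; rewrite mxE.
  case: k => [[|[|[|[|k]]]]] // Hk; [move: u00|move: u10|move: u20|move: u30];
    rewrite /u0 /u1 /u2 /u3; (move=> <-; congr (u 0 _); exact: val_inj).
have simp := (@mul0r F, @mulr0 F, @mulr1 F, @add0r F, @addr0 F, @oppr0 F).
apply: row_free_rowsmx => u; rewrite !big_ord_recl big_ord0 /= addr0.
set u0 := u 0 ord0; set u1 := u 0 _; set u2 := u 0 _ => Hu.
have H i : (i < 4)%N -> u0 * (i == 0)%:R + (u1 * (i == 1)%:R +
    (u2 * ((i == 0)%:R + (i == 1)%:R + r * (i == 2)%:R))) = 0.
  move=> Hi; have := congr1 (co i) Hu; rewrite (co0 fr) => <-.
  by rewrite /m !(linD (co_lin fr i), linZ (co_lin fr i)) !coE.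
have := H 2 isT; rewrite /= !simp => /eqP.
rewrite mulf_eq0 (negPf r0) orbF => /eqP u20.
have := H 0%N isT; rewrite u20 /= !simp => u00.
have := H 1%N isT; rewrite u20 /= !simp => u10.
apply/rowP => k; rewrite mxE.
case: k => [[|[|[|k]]]] // Hk; [move: u00|move: u10|move: u20];
  rewrite /u0 /u1 /u2; (move=> <-; congr (u 0 _); exact: val_inj).
Qed.

Lemma nth_pts C j : nth 0 (pts C) j =
  (if odd j then (nth p0 C j./2).2 else (nth p0 C j./2).1) :> vec.
Proof.
elim: C j => [|p C IH] [|[|j]] //=; last by rewrite negbK IH.
by case: ifP.
Qed.

Lemma separating_scale t (zs us : seq vec) :
  (forall z, z \in zs -> exists2 c, c != 0 & c *: z \in us) ->
  separating fr t zs -> separating fr t us.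
Proof.
move=> Hs H c Hc; apply: H => z /Hs[e e0 /Hc].
rewrite (form_homog (form_lcomb fr K t c)) => /eqP.
by rewrite mulf_eq0 expf_eq0 (negPf e0) andbF => /eqP.
Qed.

(** The block lengths put L and N at any two prescribed nonconsecutive positions, with M in
    between. *)
Lemma three_block_chain L M N i b c : okpair K L -> okpair K M -> okpair K N ->
  link A L M -> link A M N ->
  chain K (nseq i L ++ L :: nseq b M ++ M :: nseq c N ++ [:: N]).
Proof.
move=> okL okM okN LM MN.
have HN : chain K (nseq c N ++ [:: N]) by apply: chain_nseq.
have HM : chain K (nseq b M ++ M :: nseq c N ++ [:: N]).
  by apply: chain_nseq; split=> //; case: (c).
by apply: chain_nseq; split=> //; case: (b).
Qed.

(** Each requirement is an open condition on the parameters, with its own degenerate chain as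
    witness; the generic chain then satisfies all of them. *)
Lemma good_chain d : (n <= d)%N -> exists C, [/\ size C = d, chain K C,
  forall i, (i < d)%N -> forall j, (j < d)%N -> (i.+1 < j)%N ->
    row_free (rowsmx 4 [:: (nth p0 C i).1; (nth p0 C i).2; (nth p0 C j).1; (nth p0 C j).2]),
  forall i, (i.+1 < d)%N ->
    row_free (rowsmx 3 [:: (nth p0 C i).1; (nth p0 C i).2; (nth p0 C i.+1).1]) &
  forall t, (t < d.+1)%N -> row_free (evalmx fr t d.*2 (pts C)) \/
    row_free (evalmx fr t d.*2 (pts C))^T].
Proof.
move=> nd; have n3 := frame_dim fr; have d0 : (0 < d)%N by lia.
pose X : lmodType F := (vec * params d)%type.
pose C (x : X) := pchain x.1 x.2.
have sC x : size (C x) = d by apply: size_pchain.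
have pC i : [/\ polyvec (fun x : X => (nth p0 (C x) i).1),
    polyvec (fun x : X => (nth p0 (C x) i).2) &
    polyvec (fun x : X => nth 0 (pnodes x.1 x.2) i)].
  apply: (@pchain_poly X d fst snd) => //.
  exact: (@polyvec_linear F n X fst).
have reach D : size D = d -> chain K D -> exists x : X, forall i, (i < d)%N ->
    [/\ exists2 c, c != 0 & (nth p0 (C x) i).1 = c *: (nth p0 D i).1,
        exists2 c, c != 0 & (nth p0 (C x) i).2 = c *: (nth p0 D i).2 &
        q (nth 0 (pnodes x.1 x.2) i) != 0].
  case: D => [|p D] sD HD; first by exfalso; move: sD => /=; lia.
  have okp : okpair K p by case: HD.
  have [o [op qo _]] := unit_node okp.
  have [|x Hx] := pchain_reach HD erefl op; first by rewrite qo oner_neq0.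
  rewrite /C /X; case: d / sD {nd d0 X C sC pC} => //.
  by exists (o, x).
have rowpoly m (vs : X -> seq vec) :
    (forall k, polyvec (fun x => nth 0 (vs x) k)) ->
    forall i j, polyfun (fun x => rowsmx m (vs x) i j).
  by move=> pv i j; apply: polyfun_ext _ (pv i j) => x; rewrite mxE.
have pol0 : polyvec (fun _ : X => (0 : vec)) by apply: polyvec_cst.
have [L [M [N [[okL okM okN] LM MN R4 R3]]]] := three_lines.
(* Position [i] holds L, the next [b.+1] positions hold M and the following ones N; [nseq d N] makes
   the list long enough to be cut at [d]. *)
pose D i b := take d (nseq i L ++ L :: nseq b M ++ M :: nseq d N ++ [:: N]).
have sD i b : size (D i b) = d.
  by rewrite size_take !size_cat /= size_cat /= size_cat !size_nseq; case: ltnP => //; lia.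
have HD i b : chain K (D i b) by apply: chain_take; apply: three_block_chain.
have D1 i b : (i < d)%N -> nth p0 (D i b) i = L.
  by move=> Hi; rewrite nth_take // nth_cat size_nseq ltnn subnn.
have D2 i : (i.+1 < d)%N -> nth p0 (D i 0%N) i.+1 = M.
  move=> Hi; rewrite nth_take // nth_cat size_nseq ltnNge leqnSn /=.
  by rewrite subSn // subnn.
have D3 i b : (i + b.+2 < d)%N -> nth p0 (D i b) (i + b.+2) = N.
  move=> Hi; rewrite nth_take // nth_cat size_nseq ltnNge leq_addr /= addKn /=.
  rewrite nth_cat size_nseq ltnNge leqnSn /= subSn // subnn /=.
  by case: d d0 {nd X C sC pC reach rowpoly pol0 D sD HD D1 D2 Hi}.
have G1 : generic (fun x : X => forall i, (i < d)%N ->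
    B (nth p0 (C x) i).1 (nth p0 (C x) i).2 != 0).
  apply: generic_all => i Hi; have [x Hx] := reach _ (sD 0 0)%N (HD 0 0)%N.
  have [[c c0 E1] [e e0 E2] _] := Hx i Hi; have [p1 p2 _] := pC i.
  apply: (@generic_neq0 _ _ _ x); first exact: polyfun_pol.
  rewrite E1 E2 polZl (polZr fr) !mulf_neq0 //.
  have /(chain_ok (HD 0 0)%N)[] // : nth p0 (D 0 0)%N i \in D 0%N 0%N.
  by apply: mem_nth; rewrite sD.
have G2 : generic (fun x : X => forall i, (i < d)%N -> q (nth 0 (pnodes x.1 x.2) i) != 0).
  apply: generic_all => i Hi; have [x Hx] := reach _ (sD 0 0)%N (HD 0 0)%N.
  have [_ _ Hq] := Hx i Hi; have [_ _ p3] := pC i.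
  by apply: (@generic_neq0 _ _ _ x) => //; apply: polyfun_pol.
have G3 : generic (fun x : X => forall i, (i < d)%N -> forall j, (j < d)%N -> (i.+1 < j)%N ->
    row_free (rowsmx 4 [:: (nth p0 (C x) i).1; (nth p0 (C x) i).2;
                           (nth p0 (C x) j).1; (nth p0 (C x) j).2])).
  apply: generic_all => i Hi; apply: generic_all => j Hj.
  (* For the other pairs the requirement is vacuous, and any generic property implies it. *)
  have [ij|ij] := ltnP i.+1 j; last by apply: generic_imp G1 => x _.
  have [x Hx] := reach _ (sD i (j - i).-2) (HD i (j - i).-2).
  have [p1 p2 _] := pC i; have [p3 p4 _] := pC j.
  suff: generic (fun x : X => row_free (rowsmx 4 [:: (nth p0 (C x) i).1; (nth p0 (C x) i).2;
                           (nth p0 (C x) j).1; (nth p0 (C x) j).2])).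
    by apply: generic_imp.
  apply: (@generic_row_free _ _ _ _ _ x).
    by apply: rowpoly => -[|[|[|[|k]]]] //=; rewrite ?nth_nil.
  apply: row_free_rowsmx_scale R4.
  have [E1 E2 _] := Hx i Hi; have [E3 E4 _] := Hx j Hj.
  have Ej : j = (i + (j - i).-2.+2)%N by lia.
  have Dj : nth p0 (D i (j - i).-2) j = N by rewrite {2}Ej D3 // -Ej.
  rewrite D1 // in E1 E2; rewrite Dj in E3 E4.
  by move=> [|[|[|[|k]]]] //=.
have G4 : generic (fun x : X => forall i, (i < d.-1)%N ->
    row_free (rowsmx 3 [:: (nth p0 (C x) i).1; (nth p0 (C x) i).2; (nth p0 (C x) i.+1).1])).
  apply: generic_all => i Hi'; have Hi : (i.+1 < d)%N by lia.
  have [x Hx] := reach _ (sD i 0%N) (HD i 0%N).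
  have [p1 p2 _] := pC i; have [p3 _ _] := pC i.+1.
  apply: (@generic_row_free _ _ _ _ _ x).
    by apply: rowpoly => -[|[|[|k]]] //=; rewrite ?nth_nil.
  apply: row_free_rowsmx_scale R3.
  have [E1 E2 _] := Hx i (ltnW Hi); have [E3 _ _] := Hx i.+1 Hi.
  rewrite D1 1?ltnW // in E1 E2; rewrite D2 // in E3.
  by move=> [|[|[|k]]] //=.
(* The bound on [t] keeps the number of conditions finite. The alternative is settled for each [t]
   by its witness chain, and the corresponding rank condition is open. *)
have G5 : generic (fun x : X => forall t, (t < d.+1)%N ->
    row_free (evalmx fr t d.*2 (pts (C x))) \/ row_free (evalmx fr t d.*2 (pts (C x)))^T).
  apply: generic_all => t _.
  have [E [sE HE HEt]] := maximal_rank_chain fr t nd.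
  have [x Hx] := reach E sE HE.
  have ppts j : polyvec (fun x : X => nth 0 (pts (C x)) j).
    have [p1 p2 _] := pC j./2.
    case oj : (odd j).
      by move=> i; apply: polyfun_ext _ (p2 i) => y; rewrite nth_pts oj.
    by move=> i; apply: polyfun_ext _ (p1 i) => y; rewrite nth_pts oj.
  have pE i j : polyfun (fun x => evalmx fr t d.*2 (pts (C x)) i j).
    apply: polyfun_ext _ (form_polyfun (form_monom fr (nth [::] (words K t) i)) (ppts j)).
    by move=> y; rewrite mxE.
  have scale j : (j < d.*2)%N ->
      exists2 c, c != 0 & nth 0 (pts (C x)) j = c *: nth 0 (pts E) j.
    move=> Hj; have [|[c c0 E1] [e e0 E2] _] := Hx j./2; first by lia.
    by rewrite !nth_pts; case: (odd j); [exists e | exists c].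
  have sp : size (pts E) = d.*2 by rewrite size_pts sE.
  have spC : size (pts (C x)) = d.*2 by rewrite size_pts sC.
  case: HEt => [Hs|Hi].
    suff: generic (fun x : X => row_free (evalmx fr t d.*2 (pts (C x)))).
      by apply: generic_imp => y; left.
    apply: (@generic_row_free _ _ _ _ _ x) => //.
    apply: row_free_evalmx => //; apply: separating_scale Hs => z /(nthP 0)[j Hj <-].
    have [|c c0 Ec] := scale j; first by rewrite -sp.
    by exists c; rewrite -?Ec ?mem_nth // spC -sp.
  suff: generic (fun x : X => row_free (evalmx fr t d.*2 (pts (C x)))^T).
    by apply: generic_imp => y; right.
  apply: (@generic_row_free _ _ _ _ _ x).
    by move=> i j; apply: polyfun_ext _ (pE j i) => y; rewrite [RHS]mxE.
  apply: (@row_free_evalmx_tr _ _ _ fr t _ _ _ sp) => //.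
    by move=> z /(chain_pts HE)[].
  by move=> j; rewrite sp; apply: scale.
have [G [_ [x Gx] HG]] :=
  generic_and G1 (generic_and G2 (generic_and G3 (generic_and G4 G5))).
have [H1 [H2 [H3 [H4 H5]]]] := HG x Gx.
exists (C x); split=> //; first exact: pchain_chain.
by move=> i Hi; apply: H4; lia.
Qed.

End Parametrization.

(** * Normal form of a symmetric matrix *)

Section NormalForm.
Variable F : closedFieldType.
Hypothesis two : (2 : F) != 0.

Lemma closed_sqrt (a : F) : exists r, r ^+ 2 = a.
Proof.
have [|r Hr] := @quadratic_root F (- a) 0 1; first by rewrite oner_neq0 orbT.
by exists r; apply/eqP; rewrite -subr_eq0 -[X in _ == X]Hr; apply/eqP; ring.
Qed.

(** If [A i j] is nonzero and both diagonal entries vanish, the sum of the two basis vectors has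
    norm [2 * A i j]. A square root normalizes the value. *)
Lemma symmetric_unit_vector m (A : 'M[F]_m) : A^T = A -> A != 0 ->
  exists v : 'rV_m, (v *m A *m v^T) 0 0 = 1.
Proof.
move=> sA A0.
have mxe i j : ((delta_mx 0 i : 'rV_m) *m A *m (delta_mx 0 j)^T) 0 0 = A i j.
  rewrite -rowE trmx_delta mxE (bigD1 j) //= !mxE !eqxx mulr1 big1 ?addr0 //.
  by move=> k kj; rewrite !mxE (negPf kj) mulr0.
have [v Hv] : exists v : 'rV_m, (v *m A *m v^T) 0 0 != 0.
  have [[i j] /= Aij] : exists p, A p.1 p.2 != 0.
    apply/existsP; apply: contraNT A0 => /existsPn H; apply/eqP/matrixP => i j.
    by have := H (i, j); rewrite negbK mxE => /eqP.
  have [Aii|] := eqVneq (A i i) 0; last by exists (delta_mx 0 i); rewrite mxe.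
  have [Ajj|] := eqVneq (A j j) 0; last by exists (delta_mx 0 j); rewrite mxe.
  exists (delta_mx 0 i + delta_mx 0 j).
  have mxD (X Y : 'M[F]_1) : (X + Y) 0 0 = X 0 0 + Y 0 0 by rewrite mxE.
  rewrite linearD /= !mulmxDl !mulmxDr !mxD !mxe.
  rewrite Aii Ajj -{2}sA mxE add0r addr0 (_ : _ + _ = 2 * A i j) ?mulf_neq0 //; ring.
have [r Hr] := closed_sqrt ((v *m A *m v^T) 0 0).
have r0 : r != 0 by apply: contraNneq Hv => r0; rewrite -Hr r0 expr0n.
exists (r^-1 *: v); rewrite linearZ /= -!scalemxAl -scalemxAr scalerA mxE -Hr.
by rewrite -expr2 exprVn mulVf // expf_neq0.
Qed.

Lemma unitmx_first_row m (v : 'rV[F]_(1 + m)) : v != 0 ->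
  exists2 P : 'M_(1 + m), P \in unitmx & usubmx P = v.
Proof.
move=> v0; have rv : \rank v = 1%N by apply/eqP; rewrite rank_rV v0.
exists (block_mx (col_ebase v) 0 0 1%:M *m row_ebase v).
  by rewrite unitmx_mul row_ebase_unit andbT unitmxE det_ublock det1 mulr1 -unitmxE col_ebase_unit.
rewrite -[RHS](mulmx_ebase v) rv -[row_ebase v]vsubmxK.
rewrite mul_block_col !mul0mx addr0 add0r col_mxKu -mulmxA; congr (_ *m _).
rewrite (_ : pid_mx 1 = row_mx 1%:M 0) ?mul_row_col ?mul1mx ?mul0mx ?addr0 //.
apply/rowP => j; rewrite !mxE /=; case: splitP => k Hk; rewrite mxE Hk //.
by rewrite (ord1 k).
Qed.

Lemma pid_mx_add1 m r :
  block_mx 1%:M 0 0 (pid_mx r) = pid_mx (1 + r) :> 'M[F]_(1 + m).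
Proof.
apply/matrixP => i j.
case: (split_ordP i) => i' ->; case: (split_ordP j) => j' ->.
- by rewrite block_mxEul !mxE !ord1.
- by rewrite block_mxEur !mxE !ord1.
- by rewrite block_mxEdl !mxE !ord1.
by rewrite block_mxEdr !mxE /= eqn_add2l ltn_add2l.
Qed.

(** Diagonalization by congruence: a unit vector becomes the first row, its orthogonal is split off,
    and the rest follows by induction. *)
Lemma symmetric_pid_mx m (A : 'M[F]_m) : A^T = A ->
  exists2 P, P \in unitmx & P *m A *m P^T = pid_mx (\rank A).
Proof.
elim: m A => [|m IH] A sA.
  by exists 1%:M; [apply: unitmx1 | rewrite !(flatmx0, thinmx0)].
have [->|A0] := eqVneq A 0.
  by exists 1%:M; [apply: unitmx1 | rewrite mulmx0 mul0mx mxrank0 pid_mx_0].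
have [v Hv] := symmetric_unit_vector sA A0.
have v0 : v != 0.
  by apply/eqP => v0; move: Hv; rewrite v0 !mul0mx mxE => /esym/eqP; rewrite oner_eq0.
have [U uU Uv] := @unitmx_first_row m v v0.
pose A1 : 'M_(1 + m) := U *m A *m U^T.
have sA1 : A1^T = A1 by rewrite /A1 !trmx_mul trmxK sA mulmxA.
have a11 : ulsubmx A1 = 1%:M.
  rewrite /A1 -[U]vsubmxK mul_col_mx tr_col_mx mul_col_row block_mxKul Uv.
  by rewrite [LHS]mx11_scalar Hv.
have defA1 : A1 = U *m A *m U^T by [].
clearbody A1.
pose b := dlsubmx A1.
have bT : ursubmx A1 = b^T by rewrite /b trmx_dlsub sA1.
have A1E : A1 = block_mx 1%:M b^T b (drsubmx A1) by rewrite -[LHS]submxK a11 bT.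
(* Elimination with pivot 1; what remains is the Schur complement [A2]. *)
pose E : 'M_(1 + m) := block_mx 1%:M 0 (- b) 1%:M.
have uE : E \in unitmx by rewrite unitmxE det_lblock !det1 mulr1 unitr1.
pose A2 := drsubmx A1 - b *m b^T.
have EA : E *m A1 *m E^T = block_mx 1%:M 0 0 A2.
  rewrite A1E /E tr_block_mx !mulmx_block !trmx1 trmx0 linearN /=.
  rewrite !(mul1mx, mulmx1, mul0mx, mulmx0, mulNmx, mulmxN, addr0, add0r, addNr).
  by rewrite addrC.
have sA2 : A2^T = A2.
  have : (block_mx 1%:M 0 0 A2)^T = block_mx 1%:M 0 0 A2 :> 'M_(1 + m).
    by rewrite -EA !trmx_mul trmxK sA1 mulmxA.
  by rewrite tr_block_mx => /eq_block_mx[].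
have [P uP HP] := IH A2 sA2.
pose Q : 'M_(1 + m) := block_mx 1%:M 0 0 P.
have uQ : Q \in unitmx by rewrite unitmxE det_ublock det1 mul1r -unitmxE.
exists (Q *m E *m U); first by rewrite !unitmx_mul uQ uE.
have -> : Q *m E *m U *m A *m (Q *m E *m U)^T = Q *m (E *m A1 *m E^T) *m Q^T.
  by rewrite defA1 !trmx_mul !mulmxA.
have HQ : Q *m (E *m A1 *m E^T) *m Q^T = block_mx 1%:M 0 0 (pid_mx (\rank A2)).
  rewrite EA /Q tr_block_mx !mulmx_block !trmx1 !trmx0.
  by rewrite !(mul1mx, mulmx1, mul0mx, mulmx0, addr0, add0r) HP.
rewrite HQ; have -> : \rank A = (1 + \rank A2)%N.
  have <- : \rank (block_mx 1%:M 0 0 A2 : 'M_(1 + m)) = (1 + \rank A2)%N.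
    by rewrite rank_diag_block_mx mxrank1.
  rewrite -EA defA1 mxrankMfree ?row_free_unit ?unitmx_tr // eqmxMfull ?row_full_unit //.
  by rewrite mxrankMfree ?row_free_unit ?unitmx_tr // eqmxMfull ?row_full_unit.
by rewrite pid_mx_add1.
Qed.

(** Of at least four unit vectors in the diagonal form, two are turned into the hyperbolic pair
    [f 0 + r *: f 1] and [2^-1 *: (f 0 - r *: f 1)] with [r ^+ 2 = -1]; two more remain to give
    [cc 2 = cc 3 = 1]. *)
Lemma frame_exists n (A : 'M[F]_(n.+1)) : (3 <= n)%N -> A^T = A -> (4 <= \rank A)%N ->
  inhabited (frame A).
Proof.
move=> n3 sA rA; have [P uP HP] := symmetric_pid_mx sA.
have [r Hr] := closed_sqrt (-1).
pose f i : 'rV[F]_(n.+1) := row (inord i) P.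
pose x i (v : 'rV[F]_(n.+1)) : F := (v *m invmx P) 0 (inord i).
pose c i : F := (i < \rank A)%N%:R.
have pC u v : qpolar A u v = qpolar A v u.
  rewrite /qpolar (_ : u *m A *m v^T = (v *m A *m u^T)^T); first by rewrite mxE.
  by rewrite !trmx_mul trmxK sA mulmxA.
have pDl u v w : qpolar A (u + v) w = qpolar A u w + qpolar A v w.
  by rewrite /qpolar !mulmxDl mxE.
have pZl a u w : qpolar A (a *: u) w = a * qpolar A u w.
  by rewrite /qpolar -!scalemxAl mxE.
have pDr u v w : qpolar A w (u + v) = qpolar A w u + qpolar A w v by rewrite !(pC w).
have pZr a u w : qpolar A w (a *: u) = a * qpolar A w u by rewrite !(pC w).
have pE := (pDl, pDr, pZl, pZr).
have Bf i j : (i < n.+1)%N -> (j < n.+1)%N -> qpolar A (f i) (f j) = (i == j)%:R * c i.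
  move=> Hi Hj; rewrite /qpolar /f tr_row -row_mul.
  have /matrixP/(_ (inord i) (inord j)) := HP; rewrite [RHS]mxE !inordK // => H.
  transitivity ((P *m A *m P^T) (inord i) (inord j)).
    by rewrite [LHS]mxE [RHS]mxE; apply: eq_bigr => k _; congr (_ * _); rewrite mxE.
  by rewrite H -mulnb natrM.
have xf i j : (i < n.+1)%N -> (j < n.+1)%N -> x i (f j) = (i == j)%:R.
  move=> Hi Hj; rewrite /x /f -row_mul mulmxV // mxE mxE -val_eqE /= !inordK //.
  by rewrite eq_sym.
have xD i u v : x i (u + v) = x i u + x i v by rewrite /x mulmxDl mxE.
have xZ i a v : x i (a *: v) = a * x i v by rewrite /x -scalemxAl mxE.
have vf v : v = \sum_(0 <= i < n.+1) x i v *: f i.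
  rewrite big_mkord -{1}(mulmxKV uP v) mulmx_sum_row; apply: eq_bigr => i _.
  by rewrite /x /f inord_val.
have Bxf i v : (i < n.+1)%N -> qpolar A v (f i) = c i * x i v.
  move=> Hi; rewrite {1}(vf v) big_mkord.
  have pS (g : 'I_n.+1 -> 'rV[F]_(n.+1)) w : qpolar A (\sum_k g k) w = \sum_k qpolar A (g k) w.
    elim/big_ind2: _ => // [|a1 b1 a2 b2 <- <-]; last by rewrite pDl.
    by rewrite -(scale0r (0 : 'rV[F]_(n.+1))) pZl mul0r.
  rewrite pS (bigD1 (Ordinal Hi)) //= big1 ?addr0 => [|k ki].
    by rewrite pZl Bf // eqxx mul1r mulrC.
  rewrite pZl Bf // (_ : (k == i :> nat) = false) ?mul0r ?mulr0 //.
  by apply: contraNF ki => /eqP ki; apply/eqP/val_inj.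
have c1 i : (i < 4)%N -> c i = 1 by move=> Hi; rewrite /c (leq_trans Hi rA).
pose e0 := f 0%N + r *: f 1%N; pose e1 := 2^-1 *: (f 0%N - r *: f 1%N).
pose eb i := if i is i'.+1 then if i' is _.+1 then f i else e1 else e0.
(* In a hyperbolic pair each coordinate is the product with the other vector. *)
pose co i v := if i is i'.+1 then if i' is _.+1 then x i v else qpolar A v e0 else qpolar A v e1.
have [n0 n1 n2] : [/\ (0 < n.+1)%N, (1 < n.+1)%N & (2 < n.+1)%N] by split; lia.
have Ev0 v : qpolar A v e0 = x 0%N v + r * x 1%N v.
  by rewrite /e0 !pE !Bxf // !c1 // !mul1r.
have Ev1 v : qpolar A v e1 = 2^-1 * (x 0%N v - r * x 1%N v).
  by rewrite /e1 -scaleNr !pE !Bxf // !c1 // !mul1r mulNr.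
have xe0 i : (i < n.+1)%N -> x i e0 = (i == 0)%:R + r * (i == 1)%:R.
  by move=> Hi; rewrite /e0 xD xZ !xf.
have xe1 i : (i < n.+1)%N -> x i e1 = 2^-1 * ((i == 0)%:R - r * (i == 1)%:R).
  by move=> Hi; rewrite /e1 xZ -scaleNr xD xZ !xf // mulNr.
have rr : r * r = -1 by rewrite -expr2.
have co_lin i : lin (co i).
  case: i => [|[|i]]; try exact: pol_lin.
  by exists (col (inord i.+2) (invmx P)) => v; rewrite /co /x colE mulmxA -colE [RHS]mxE.
constructor; apply: (@Frame F n A co eb c two n3 co_lin) => //.
- case=> [|[|i]] [|[|j]] Hi Hj; rewrite /co /eb ?Ev0 ?Ev1 ?xe0 ?xe1 ?xf //=.
  + rewrite !(mulr0, mulr1, addr0, add0r) rr opprK.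
    by rewrite (_ : 1 + 1 = 2) ?mulVf //; ring.
  + rewrite !(mulr0, mulr1, addr0, add0r, sub0r, subr0).
    rewrite (_ : _ * _ = 2^-1 * 2^-1 * (1 + r * r)); last by ring.
    by rewrite rr subrr mulr0.
  + by rewrite !mulr0 subr0 mulr0.
  + by rewrite !(mulr0, mulr1, addr0, add0r) rr subrr.
  + rewrite !(mulr0, mulr1, addr0, add0r, sub0r, subr0).
    rewrite (_ : _ + _ = 2^-1 * (1 - r * r)); last by ring.
    by rewrite rr opprK (_ : 1 + 1 = 2) ?mulVf //; ring.
  + by rewrite !mulr0 addr0.
  + by rewrite mulr0 addr0.
  + by rewrite mulr0 subr0 mulr0.
- move=> v; rewrite -(big_mkord xpredT (fun i => co i v *: eb i)) {1}(vf v).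
  rewrite !(big_ltn n0) !(big_ltn n1) !addrA; congr (_ + _).
    rewrite /co /eb Ev0 Ev1 /e0 /e1; apply/rowP => i; rewrite !mxE.
    move: (x 0%N v) (x 1%N v) (P _ i) (P _ i) => a b u w.
    rewrite [RHS](_ : _ = 2^-1 * 2 * (a * w - r * r * (b * u))); last by ring.
    by rewrite rr mulVf // mul1r mulN1r opprK.
  by rewrite !big_nat; apply: eq_bigr => -[|[|i]].
- by move=> i; rewrite /c; case: (i < _)%N; [right | left].
- exact: c1.
- exact: c1.
- by move=> [|[|i]] v // Hi; rewrite Bxf.
Qed.
End NormalForm.

(** * From a generic chain to the bamboo and its intersection with the quadric *)

Section Bamboo.
Variables (F : closedFieldType) (n : nat) (A : 'M[F]_(n.+1)) (fr : frame A).
Local Notation vec := 'rV[F]_(n.+1).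
Local Notation B := (qpolar A).
Local Notation q := (qform A).
Local Notation K := n.-1.
Local Notation p0 := ((0, 0) : vec * vec).
Variables (d : nat) (C : seq (vec * vec)).
Hypotheses (sC : size C = d) (HC : chain fr K C).
Hypothesis disjoint_lines :
  forall i, (i < d)%N -> forall j, (j < d)%N -> (i.+1 < j)%N ->
    row_free (rowsmx 4 [:: (nth p0 C i).1; (nth p0 C i).2; (nth p0 C j).1; (nth p0 C j).2]).
Hypothesis distinct_lines : forall i, (i.+1 < d)%N ->
    row_free (rowsmx 3 [:: (nth p0 C i).1; (nth p0 C i).2; (nth p0 C i.+1).1]).

Definition bamboo (i : 'I_d) : 'M[F]_(2, n.+1) :=
  col_mx (nth p0 C i).1 (nth p0 C i).2 : 'M_(1 + 1, n.+1).

Lemma mulmx_bamboo (u : 'rV_2) i : u *m bamboo i =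
  u 0 ord0 *: (nth p0 C i).1 + u 0 (lift ord0 ord0) *: (nth p0 C i).2.
Proof.
pose w : 'rV_(1 + 1) := u.
transitivity (row_mx (lsubmx w) (rsubmx w) *m col_mx (nth p0 C i).1 (nth p0 C i).2).
  by rewrite hsubmxK.
rewrite mul_row_col [lsubmx _]mx11_scalar [rsubmx _]mx11_scalar.
rewrite !mul_scalar_mx mxE [rsubmx _ 0 0]mxE.
by congr (u _ _ *: _ + u _ _ *: _); apply: val_inj.
Qed.

Lemma on_lineP (i : 'I_d) p : reflect (on_pair p (nth p0 C i)) (on_line p (bamboo i)).
Proof.
apply: (iffP submxP) => [[D ->]|[x [y ->]]].
  by exists (D 0 ord0), (D 0 (lift ord0 ord0)); apply: mulmx_bamboo.
exists (row_mx x%:M y%:M : 'M_(1, 1 + 1)).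
transitivity (row_mx x%:M y%:M *m col_mx (nth p0 C i).1 (nth p0 C i).2) => //.
by rewrite mul_row_col !mul_scalar_mx.
Qed.

Lemma nth_ok i : (i < d)%N -> okpair fr K (nth p0 C i).
Proof. by move=> Hi; apply: (chain_ok HC); apply: mem_nth; rewrite sC. Qed.

Lemma chain_link D i : chain fr K D -> (i.+1 < size D)%N ->
  link A (nth p0 D i) (nth p0 D i.+1).
Proof.
elim: D i => [|p D IH] // i [_ Hl HD] Hi; case: i Hi => [|i] Hi; last exact: IH.
by case: D Hl Hi {IH HD}.
Qed.

Lemma consecutive_meet i : (i.+1 < d)%N -> exists o, [/\ q o != 0,
  on_pair o (nth p0 C i), on_pair o (nth p0 C i.+1) &
  forall p, on_pair p (nth p0 C i) -> on_pair p (nth p0 C i.+1) -> exists c, p = c *: o].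
Proof.
move=> Hi; have [|o [Ho1 Ho2 qo]] := @chain_link C i HC; first by rewrite sC.
exists o; split=> // p [x [y Ep]] [x' [y' Ep']].
have [u [v Eo]] := Ho1; have [u' [v' Eo']] := Ho2.
have okp := nth_ok Hi; case: (okp) => _ _ q1 q2 _.
have v'0 : v' != 0.
  by apply: contraNneq qo => v'0; rewrite Eo' (qform_lc fr) // v'0 mulr0 mul0r.
(* This multiple of [o] cancels the component along the second point of the next line, leaving a
   relation between the three independent points. *)
pose c := y' / v'; exists c.
have E : (x - c * u) *: (nth p0 C i).1 + (y - c * v) *: (nth p0 C i).2 =
         (x' - c * u') *: (nth p0 C i.+1).1.
  transitivity (p - c *: o).
    by rewrite Ep Eo; apply/rowP => k; rewrite !mxE; ring.
  have cv : c * v' = y' by rewrite divfK.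
  by rewrite Ep' Eo' -cv; apply/rowP => k; rewrite !mxE; ring.
pose w : 'rV[F]_3 := \row_k [:: x - c * u; y - c * v; - (x' - c * u')]`_k.
have w0 : w = 0.
  apply: (rowsmx_inj (distinct_lines Hi)).
  rewrite !big_ord_recl big_ord0 !mxE /= addr0 addrA E scaleNr subrr //.
have /eqP : w 0 ord0 = 0 by rewrite w0 mxE.
rewrite mxE /= subr_eq0 => /eqP Ex.
have /eqP : w 0 (lift ord0 ord0) = 0 by rewrite w0 mxE.
rewrite mxE /= subr_eq0 => /eqP Ey.
by rewrite Ep Eo Ex Ey scalerDr !scalerA.
Qed.

Lemma far_disjoint i j p : (i < d)%N -> (j < d)%N -> (i.+1 < j)%N ->
  on_pair p (nth p0 C i) -> on_pair p (nth p0 C j) -> p = 0.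
Proof.
move=> Hi Hj ij [x [y Ep]] [x' [y' Ep']].
pose w : 'rV[F]_4 := \row_k [:: x; y; - x'; - y']`_k.
have w0 : w = 0.
  apply: (rowsmx_inj (disjoint_lines Hi Hj ij)).
  rewrite !big_ord_recl big_ord0 !mxE /= addr0 addrA -Ep !scaleNr -opprD -Ep' subrr //.
have := congr1 (fun w : 'rV_4 => w 0 ord0) w0; rewrite !mxE /= => x0.
have := congr1 (fun w : 'rV_4 => w 0 (lift ord0 ord0)) w0; rewrite !mxE /= => y0.
by rewrite Ep x0 y0 !scale0r addr0.
Qed.

(** A point on two of the lines is a node, and nodes are off the quadric. *)
Lemma isotropic_unique i j p : (i < d)%N -> (j < d)%N -> p != 0 -> q p = 0 ->
  on_pair p (nth p0 C i) -> on_pair p (nth p0 C j) -> i = j.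
Proof.
wlog ij : i j / (i < j)%N.
  move=> H Hi Hj p1 qp Pi Pj; have [ij|ij|//] := ltngtP i j.
    exact: (H i j).
  by apply/esym; apply: (H j i).
move=> Hi Hj pn0 qp Pi Pj; exfalso.
have [Ej|ij'] : j = i.+1 \/ (i.+1 < j)%N by lia.
  rewrite Ej in Hj Pj; have [o [qo _ _ Ho]] := consecutive_meet Hj.
  have [c Ec] := Ho p Pi Pj.
  have c0 : c != 0 by apply: contraNneq pn0 => c0; rewrite Ec c0 scale0r.
  by move/eqP: qp; rewrite Ec qE polZl (polZr fr) !mulf_eq0 (negPf c0) (negPf qo).
by move/eqP: pn0; apply; apply: (far_disjoint Hi Hj ij' Pi Pj).
Qed.

Lemma on_pair1 (p : vec * vec) : on_pair p.1 p.
Proof. by exists 1, 0; rewrite scale1r scale0r addr0. Qed.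

Lemma on_pair2 (p : vec * vec) : on_pair p.2 p.
Proof. by exists 0, 1; rewrite scale1r scale0r add0r. Qed.

Lemma okpair_neq0 k (p : vec * vec) : okpair fr k p -> p.1 != 0 /\ p.2 != 0.
Proof.
have B0 v : B 0 v = 0 by rewrite -(scale0r (0 : vec)) polZl mul0r.
move=> [_ _ _ _ H]; split; apply: contraNneq H => ->; first by rewrite B0.
by rewrite (polC fr) B0.
Qed.

Lemma bamboo_is_bamboo : is_bamboo bamboo.
Proof.
have meet i j : (i < d)%N -> (j < d)%N ->
    (exists p, [/\ p != 0, on_pair p (nth p0 C i) & on_pair p (nth p0 C j)]) <->
    (i <= j.+1 /\ j <= i.+1)%N.
  wlog ij : i j / (i <= j)%N.
    move=> H Hi Hj; have [ij|/ltnW ij] := leqP i j; first exact: H.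
    have [H1 H2] := H j i ij Hj Hi; split.
      by move=> [p [? ? ?]]; have [] : (j <= i.+1 /\ i <= j.+1)%N by apply: H1; exists p.
    by move=> [? ?]; have [|p [? ? ?]] := H2; [|exists p].
  move=> Hi Hj; split=> [[p [pn0 Pi Pj]]|[_ ji]].
    split; first by lia.
    rewrite leqNgt; apply/negP => ij'; move/eqP: pn0; apply.
    exact: (far_disjoint Hi Hj ij').
  have [Ej|Ej] : j = i \/ j = i.+1 by lia.
    rewrite Ej; exists (nth p0 C i).1; split; try exact: on_pair1.
    by have [] := okpair_neq0 (nth_ok Hi).
  rewrite Ej in Hj *; have [o [qo Ho1 Ho2 _]] := consecutive_meet Hj.
  exists o; split=> //; apply: contraNneq qo => ->.
  by rewrite qE -(scale0r (0 : vec)) polZl mul0r.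
split.
- move=> i; apply/eqP; rewrite -[_ == _]/(row_free (bamboo i)) -kermx_eq0.
  apply/eqP/row_matrixP => l; rewrite row0; set u := row l _.
  have uL : u *m bamboo i = 0 by rewrite /u -row_mul mulmx_ker row0.
  have [_ _ q1 q2 B12] := nth_ok (ltn_ord i).
  have := mulmx_bamboo u i; rewrite uL => E.
  have B0 v : B 0 v = 0 by rewrite -(scale0r (0 : vec)) polZl mul0r.
  have /eqP := congr1 (B^~ (nth p0 C i).2) E.
  rewrite B0 polDl !polZl -(qE A _.2) q2 mulr0 addr0 eq_sym mulf_eq0 (negPf B12) orbF.
  move=> /eqP u0.
  have /eqP := congr1 (B^~ (nth p0 C i).1) E.
  rewrite B0 polDl !polZl (polC fr _.2) u0 mul0r add0r eq_sym mulf_eq0 (negPf B12) orbF.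
  move=> /eqP u1.
  apply/rowP => k; rewrite [RHS]mxE.
  by case: k => [[|[|k]]] // Hk; [move: u0 | move: u1] => <-; congr (u 0 _); apply: val_inj.
- move=> i j /eqmxP Eij; apply: val_inj.
  have [p1 _] := okpair_neq0 (nth_ok (ltn_ord i)).
  have [_ _ q1 _ _] := nth_ok (ltn_ord i).
  apply: (isotropic_unique (ltn_ord i) (ltn_ord j) p1 q1 (on_pair1 _)).
  by apply/on_lineP; rewrite /on_line -Eij; apply/on_lineP; apply: on_pair1.
move=> i j; have [H1 H2] := meet i j (ltn_ord i) (ltn_ord j); split.
  by move=> [p [pn0 [/on_lineP Pi /on_lineP Pj]]]; apply: H1; exists p.
move=> /H2[p [pn0 Pi Pj]]; exists p; split=> //.
by split; apply/on_lineP.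
Qed.

(** On a line the quadratic form is [2 * x * y * B p.1 p.2], which vanishes only at the two recorded
    points. *)
Lemma in_TW_pts p : in_TW A bamboo p ->
  exists2 z, z \in pts C & exists2 c, c != 0 & p = c *: z.
Proof.
move=> [pn0 [i /on_lineP[x [y Ep]]] qp].
have [_ _ q1 q2 B12] := nth_ok (ltn_ord i).
have mem j : (j < d)%N -> (nth p0 C j).1 \in pts C /\ (nth p0 C j).2 \in pts C.
  rewrite -sC; elim: (C) j => [|p' D IH] [|j] //= Hj; rewrite !inE ?eqxx ?orbT //.
  by have [-> ->] := IH j Hj; rewrite !orbT.
have [m1 m2] := mem i (ltn_ord i).
move: qp; rewrite Ep (qform_lc fr) // => /eqP; rewrite !mulf_eq0 (negPf B12) orbF.
rewrite (negPf (two_neq0 fr)) /= => /orP[/eqP x0|/eqP y0].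
  rewrite x0 scale0r add0r in Ep; exists (nth p0 C i).2 => //; exists y.
    by apply: contraNneq pn0 => y0; rewrite Ep y0 scale0r.
  by rewrite x0 scale0r add0r.
rewrite y0 scale0r addr0 in Ep; exists (nth p0 C i).1 => //; exists x.
  by apply: contraNneq pn0 => x0; rewrite Ep x0 scale0r.
by rewrite y0 scale0r addr0.
Qed.

Lemma pts_in_TW z : z \in pts C -> in_TW A bamboo z.
Proof.
move=> /pts_pairs[p /(nthP p0)[i Hi <-] Hz]; rewrite sC in Hi.
have [n1 n2] := okpair_neq0 (nth_ok Hi); have [_ _ q1 q2 _] := nth_ok Hi.
case: Hz => ->; split=> //; exists (Ordinal Hi); apply/on_lineP.
  exact: on_pair1.
exact: on_pair2.
Qed.

(** At one point of a line on the quadric, the other such point is a direction outside the tangent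
    hyperplane; this also shows that the gradient is nonzero. *)
Lemma bamboo_transversal : meets_transversally A bamboo.
Proof.
move=> p Hp; have [pn0 _ qp] := Hp.
have uniq_line i j : on_line p (bamboo i) -> on_line p (bamboo j) -> i = j.
  move=> /on_lineP Pi /on_lineP Pj; apply: val_inj.
  exact: (isotropic_unique (ltn_ord i) (ltn_ord j) pn0 qp Pi Pj).
have partner i : on_line p (bamboo i) -> exists v, on_line v (bamboo i) /\ B p v != 0.
  move=> /on_lineP[x [y Ep]]; have [_ _ q1 q2 B12] := nth_ok (ltn_ord i).
  have [x0|x0] := eqVneq x 0; last first.
    exists (nth p0 C i).2; split; first by apply/on_lineP; apply: on_pair2.
    by rewrite Ep polDl !polZl -(qE A _.2) q2 mulr0 addr0 mulf_neq0.
  have y0 : y != 0 by apply: contraNneq pn0 => y0; rewrite Ep x0 y0 !scale0r addr0.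
  exists (nth p0 C i).1; split; first by apply/on_lineP; apply: on_pair1.
  by rewrite Ep polDl !polZl x0 mul0r add0r (polC fr) mulf_neq0.
split=> //.
have [_ [i Pi] _] := Hp; have [v [_ Bpv]] := partner i Pi.
by apply: contraNneq Bpv => pA; rewrite /qpolar pA mul0mx mxE.
Qed.

Lemma bamboo_repr : repr_TW A bamboo (pts C).
Proof.
split.
- exact: pts_in_TW.
- move=> p /in_TW_pts[z Hz [c _ ->]]; exists z => //.
  exact: scalemx_sub.
apply/(pairwiseP 0) => i j; rewrite !inE size_pts sC => Hi Hj ij.
apply/negP => Hs.
have Hi2 : (i./2 < d)%N by lia.
have Hj2 : (j./2 < d)%N by lia.
have [zn0 _ qz] : in_TW A bamboo (nth 0 (pts C) i).
  by apply: pts_in_TW; apply: mem_nth; rewrite size_pts sC.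
have on k : on_pair (nth 0 (pts C) k) (nth p0 C k./2).
  by rewrite nth_pts; case: ifP => _; [apply: on_pair2 | apply: on_pair1].
have [c Ec] : exists c, nth 0 (pts C) i = c *: nth 0 (pts C) j by apply/sub_rVP.
have E2 : i./2 = j./2.
  apply: (isotropic_unique Hi2 Hj2 zn0 qz (on i)).
  by rewrite Ec; apply: on_pairZ.
(* The indices [i < j] belong to the same line, so they are those of its first and second point,
   which cannot be proportional as they are isotropic and not orthogonal. *)
have [oi oj] : odd i = false /\ odd j = true.
  have := odd_double_half i; have := odd_double_half j; rewrite -E2.
  by case: (odd i); case: (odd j) => //=; lia.
have [_ _ q1 q2 B12] := nth_ok Hi2.
move: Ec; rewrite !nth_pts oi oj -E2 => Ec.
by move/eqP: B12; apply; rewrite Ec polZl -(qE A _.2) q2 mulr0.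
Qed.

Lemma bamboo_injective t : row_free (evalmx fr t d.*2 (pts C)) ->
  restr_injective A bamboo t.
Proof.
have sp : size (pts C) = d.*2 by rewrite size_pts sC.
move=> /(separating_evalmx sp) Hs f Hf Hv; have [c [g Ef]] := homog_spanned fr Hf.
exists g; rewrite Ef big_nat big1 ?add0r // => i /andP[_ Hi].
rewrite (Hs c) ?scale0r // => z Hz.
have [_ _ qz] := pts_in_TW Hz.
have := Hv z (pts_in_TW Hz); rewrite Ef /evalp mevalD mevalM -![meval _ _]/(evalp _ z).
rewrite evalp_quadric qz mul0r addr0 /evalp raddf_sum /= => H.
rewrite -[RHS]H; apply: eq_bigr => j _ /=.
by rewrite mevalZ -/(evalp _ _) evalp_mpmonom.
Qed.

Lemma mpmonom_homog w : mpmonom fr w \is (size w).-homog.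
Proof.
rewrite /mpmonom; elim: w => [|k w IH]; first by rewrite big_nil dhomog1.
rewrite big_cons; apply: (@dhomogM _ _ _ 1%N) => //; apply: rpred_sum => j _.
by apply: dhomogZ; rewrite dhomogX; apply/eqP; apply: mdeg1.
Qed.

Lemma bamboo_surjective t : row_free (evalmx fr t d.*2 (pts C))^T ->
  restr_surjective (pts C) t.
Proof.
have sp : size (pts C) = d.*2 by rewrite size_pts sC.
move=> /row_freeP[D HD] vs svs.
pose v := \row_(j < d.*2) vs`_j.
have Hr : (v *m D^T) *m evalmx fr t d.*2 (pts C) = v.
  by rewrite -mulmxA -[evalmx _ _ _ _]trmxK -trmx_mul HD trmx1 mulmx1.
exists (\sum_i (v *m D^T) 0 i *: mpmonom fr (nth [::] (words K t) i)).
  apply: rpred_sum => i _; apply: dhomogZ.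
  have := mpmonom_homog (nth [::] (words K t) i).
  by rewrite (size_words (mem_nth [::] (ltn_ord i))).
move=> k; rewrite sp => Hk; have /rowP/(_ (Ordinal Hk)) := Hr.
rewrite [RHS]mxE => <-; rewrite mxE /evalp raddf_sum; apply: eq_bigr => i _ /=.
by rewrite mevalZ -/(evalp _ _) evalp_mpmonom [evalmx _ _ _ _ _ _]mxE.
Qed.

End Bamboo.

(** A form vanishing at all points but one is multiplied by a coordinate that is nonzero at the
    remaining point; the results are added up. *)
Lemma restr_surjective_succ (F : fieldType) n (zs : seq 'rV[F]_(n.+1)) t :
  (forall z, z \in zs -> z != 0) -> restr_surjective zs t -> restr_surjective zs t.+1.
Proof.
move=> nz Hs vs svs.
have H k : (k < size zs)%N -> exists2 f : {mpoly F[n.+1]}, f \is t.+1.-homog &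
    forall l, (l < size zs)%N -> evalp f (nth 0 zs l) = vs`_k * (l == k)%:R.
  move=> Hk; have [f Hf fz] := Hs [seq (l == k)%:R | l <- iota 0 (size zs)]
     (etrans (size_map _ _) (size_iota _ _)).
  have /rV0Pn[j zj] := nz _ (mem_nth 0 Hk).
  exists ((vs`_k / (nth 0 zs k) 0 j) *: ('X_j * f)).
    apply: dhomogZ; apply: (@dhomogM _ _ _ 1%N) => //.
    by rewrite dhomogX; apply/eqP; apply: mdeg1.
  move=> l Hl; rewrite /evalp mevalZ mevalM mevalXU -/(evalp _ _) fz //.
  rewrite (nth_map 0%N) ?size_iota // nth_iota // add0n.
  by have [->|_] := eqVneq l k; rewrite ?mulr0 // mulr1 divfK // mulr1.
have [f [Hf fz]] : exists f : {mpoly F[n.+1]}, f \is t.+1.-homog /\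
    forall l, (l < size zs)%N ->
      evalp f (nth 0 zs l) = \sum_(0 <= k < size zs) vs`_k * (l == k)%:R.
  suff: forall m, (m <= size zs)%N -> exists f : {mpoly F[n.+1]}, f \is t.+1.-homog /\
    forall l, (l < size zs)%N ->
      evalp f (nth 0 zs l) = \sum_(0 <= k < m) vs`_k * (l == k)%:R by apply.
  elim=> [|m IH] Hm.
    exists 0; split; first exact: dhomog0.
    by move=> l _; rewrite /evalp meval0 big_geq.
  have [f [Hf fz]] := IH (ltnW Hm); have [g Hg gz] := H m Hm.
  exists (f + g); split; first exact: dhomogD.
  by move=> l Hl; rewrite /evalp mevalD -!/(evalp _ _) fz // gz // big_nat_recr.
exists f => // l Hl; rewrite fz // (bigD1_seq l) ?mem_index_iota ?iota_uniq //=.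
rewrite eqxx mulr1 big1 ?addr0 // => k kl.
by rewrite eq_sym (negPf kl) mulr0.
Qed.

Theorem theorem2 (F : closedFieldType) (charF0 : [pchar F] =i pred0)
  (n d rho : nat) (A : 'M[F]_(n.+1)) :
  (3 <= n)%N -> (n <= d)%N ->
  A^T = A -> \rank A = rho -> (4 <= rho)%N ->
  exists L : 'I_d -> 'M[F]_(2, n.+1),
    [/\ is_bamboo L, meets_transversally A L &
        exists zs : seq 'rV[F]_(n.+1),
          repr_TW A L zs /\
          forall t : nat, restr_injective A L t \/ restr_surjective zs t].
Proof.
move=> n3 nd sA rA rho4.
have two : (2 : F) != 0.
  by have := charF0 2; rewrite inE /= => /negbT.
have [fr] : inhabited (frame A) by apply: frame_exists => //; rewrite rA.
have [C [sC HC H3 H4 H5]] := good_chain fr nd.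
exists (bamboo C); split.
- exact: (bamboo_is_bamboo sC HC H3 H4).
- exact: (bamboo_transversal sC HC H3 H4).
exists (pts C); split; first exact: (bamboo_repr sC HC H3 H4).
move=> t; have [td|dt] := ltnP t d.+1.
  have [Hi|Hs] := H5 t td.
    by left; apply: (bamboo_injective sC HC Hi).
  by right; apply: (bamboo_surjective sC Hs).
(* Injectivity in degree [d] would bound the number of basis forms by the number [d.*2] of points,
   against [size_words_gt]. *)
right; have Sd : restr_surjective (pts C) d.
  have [Hi|Hs] := H5 d (ltnSn d); last exact: (bamboo_surjective sC Hs).
  have := rank_leq_col (evalmx fr d d.*2 (pts C)); rewrite (eqP Hi).
  have := size_words_gt n.-2 d; have -> : n.-2.+1 = n.-1 by lia.
  by move=> H1 H2; exfalso; lia.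
have nz z : z \in pts C -> z != 0.
  by move=> /(pts_in_TW sC HC)[].
elim: t dt => // t IH; rewrite ltnS leq_eqVlt => /orP[/eqP <-|dt].
  exact: restr_surjective_succ.
by apply: restr_surjective_succ => //; apply: IH.
Qed.
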